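(* Let $\{p_n\}_{n\in\mathbb{N}}$ be an increasing sequence in $(0,1]$, let $\{\omega_n\}_{n\in\mathbb{N}}$ be a family of weights on $\mathbb{Z}$ with $\omega_n\ge\omega_{n+1}$ for all $n$, and let $\mathcal{X}=\bigcup_{n\in\mathbb{N}}\ell^{p_n}_{\omega_n}(\mathbb{Z},\mathcal{A})$ (an algebra of Type-II). Let $f\in\mathcal{X}$ be such that $\widehat f(z)$ is left invertible (respectively, right invertible, invertible) in $\mathcal{A}$ for all $z\in\mathbb{T}$. Assume further that if $f\in\ell^{p_j}_{\omega_j}(\mathbb{Z},\mathcal{A})$ for some $j\in\mathbb{N}$ such that $\omega_j$ is not admissible and $\omega_{j+1}$ is admissible, then the sequence $\{p_n\}_{n>j}$ is strictly increasing. Then there exists a family of weights $\{\nu_n\}_{n\in\mathbb{N}}$ on $\mathbb{Z}$ such that for all $n\in\mathbb{N}$: (1) $\nu_n\le\omega_n$; (2) $\nu_n$ is constant (nonconstant) if $\omega_n$ is constant (nonconstant), provided that all the $\omega_n$ are admissible or none of them are; (3) $\nu_n$ is admissible (nonadmissible) if $\omega_n$ is admissible (nonadmissible); (4) $\nu_{n+1}\le\nu_n$; and (5) a left inverse (respectively, right inverse, inverse) of $f$ is in $\bigcup_{n\in\mathbb{N}}\ell^{p_n}_{\nu_n}(\mathbb{Z},\mathcal{A})$, which is an algebra of Type-II. In particular, $\mathcal{X}$ is inverse-closed if and only if $\{\omega_n\}_{n\in\mathbb{N}}$ satisfies the extended GRS condition.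
   Context: $\mathbb{N}$ is the set of positive integers and $\mathbb{T}$ the unit circle in $\mathbb{C}$. $\mathcal{A}$ is a complex unital Banach algebra, not necessarily commutative, with norm $\|\cdot\|$ and unit $1_{\mathcal A}$. A weight on $\mathbb{Z}$ is a map $\omega:\mathbb{Z}\to[1,\infty)$ with $\omega(x+y)\le\omega(x)\omega(y)$ for all $x,y$; inequalities between weights are pointwise. A weight $\omega$ on $\mathbb{Z}$ is admissible if it satisfies the GRS condition $\lim_{n\to\infty}\omega(nk)^{1/n}=1$ for all $k\in\mathbb{Z}$; otherwise it is nonadmissible. A family $\{\omega_n\}_{n\in\mathbb{N}}$ of weights on $\mathbb{Z}$ satisfies the extended GRS condition if $\inf_{n\in\mathbb{N}}\big(\lim_{k\to\infty}\omega_n(km)^{1/k}\big)=1$ for all $m\in\mathbb{Z}$. For $0<p\le1$, $\ell^p_\omega(\mathbb{Z},\mathcal{A})=\{f:\mathbb{Z}\to\mathcal{A}:\sum_n\|f(n)\|^p\omega(n)^p<\infty\}$, an algebra under convolution $(f\star g)(n)=\sum_m f(n-m)g(m)$ with unit $\delta_0$ ($\delta_0(0)=1_{\mathcal A}$, zero elsewhere); it is contained in $\ell^1(\mathbb{Z},\mathcal{A})$ (the case $p=1$, $\omega\equiv1$). For $f\in\ell^1(\mathbb{Z},\mathcal{A})$, $\widehat f(z)=\sum_{n\in\mathbb{Z}}f(n)z^n$ for $z\in\mathbb{T}$. Inverses of $f$ are with respect to convolution. Type-II algebra: $\bigcup_n\ell^{p_n}_{\omega_n}(\mathbb{Z},\mathcal{A})$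 with $\{p_n\}$ an increasing (not necessarily strictly) sequence in $(0,1]$ and $\{\omega_n\}$ weights with $\omega_n\ge\omega_{n+1}$ for all $n$. A subalgebra $\mathcal{X}$ of $\ell^1(\mathbb{Z},\mathcal{A})$ is inverse-closed if every $f\in\mathcal{X}$ that is invertible in $\ell^1(\mathbb{Z},\mathcal{A})$ is invertible in $\mathcal{X}$ (equivalently, if $f\in\mathcal{X}$ and $\widehat f(z)$ is invertible for all $z\in\mathbb{T}$, then $f$ is invertible in $\mathcal{X}$). *)

(* Defs.v *)
From HB Require Import structures.
From mathcomp Require Import all_boot all_order all_algebra.
From mathcomp Require Import complex.
From mathcomp Require Import all_classical all_reals all_analysis.

Set Implicit Arguments.
Unset Strict Implicit.
Unset Printing Implicit Defensive.
Import Order.TTheory GRing.Theory Num.Theory.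
Import numFieldNormedType.Exports.

Local Open Scope classical_set_scope.
Local Open Scope ring_scope.
Local Open Scope complex_scope.

(* The library has no normed algebras, and Hierarchy Builder rejects the join of
   GRing.Algebra and CompleteNormedModule (numDomainType is already declared as
   a common descendant of rings and normed groups). The product and the unit
   are therefore mixin fields, from which the algType structure is rebuilt.
   The unit is nonzero, but it is not required to have norm 1. *)
HB.mixin Record CompleteNormedModule_isBanachAlgebra (K : numFieldType) A
    & CompleteNormedModule K A := {
  bmul : A -> A -> A;
  bone : A;
  bmulA : associative bmul;
  bmul1x : left_id bone bmul;
  bmulx1 : right_id bone bmul;
  bmulDl : left_distributive bmul +%R;
  bmulDr : right_distributive bmul +%R;
  bone_neq0 : bone != 0;
  bscaleAl : forall (k : K) (x y : A), k *: bmul x y = bmul (k *: x) y;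
  bscaleAr : forall (k : K) (x y : A), k *: bmul x y = bmul x (k *: y);
  bnormM_le : forall x y : A, `|bmul x y| <= `|x| * `|y|
}.

#[short(type="banachAlgType")]
HB.structure Definition BanachAlgebra (K : numFieldType) :=
  {A of CompleteNormedModule K A & CompleteNormedModule_isBanachAlgebra K A}.

Section BanachAlgebraIsAlgebra.
Variables (K : numFieldType) (A : banachAlgType K).

#[non_forgetful_inheritance]
HB.instance Definition _ := GRing.Zmodule_isNzRing.Build A
  bmulA bmul1x bmulx1 bmulDl bmulDr bone_neq0.

#[non_forgetful_inheritance]
HB.instance Definition _ := GRing.Lmodule_isLalgebra.Build K A bscaleAl.

#[non_forgetful_inheritance]
HB.instance Definition _ := GRing.Lalgebra_isAlgebra.Build K A bscaleAr.

End BanachAlgebraIsAlgebra.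

Section Weights.
Context {R : realType}.

Definition weight (w : int -> R) : Prop :=
  (forall x, 1 <= w x) /\ (forall x y, w (x + y) <= w x * w y).

Definition admissible (w : int -> R) : Prop :=
  forall k : int,
    (fun n : nat => w (n%:Z * k) `^ n%:R^-1) @ \oo --> (1 : R).

Definition extended_GRS (w : nat -> int -> R) : Prop :=
  forall m : int,
    inf [set limn (fun k : nat => w n (k%:Z * m) `^ k%:R^-1)
        | n in [set: nat]] = 1.

Definition constant_weight (w : int -> R) : Prop :=
  exists c : R, forall x, w x = c.

(* Sequences are indexed from 0 instead of 1. *)
Definition typeII_family (p : nat -> R) (w : nat -> int -> R) : Prop :=
  [/\ forall n, 0 < p n <= 1,
      forall n, p n <= p n.+1,
      forall n, weight (w n)
    & forall n x, w n.+1 x <= w n x].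

End Weights.

Variant side := LeftInv | RightInv | TwoSidedInv.

(* y is a left, right or two-sided inverse of x for the product mul *)
Definition is_inverse (s : side) {T : Type} (mul : T -> T -> T) (one : T)
    (y x : T) : Prop :=
  match s with
  | LeftInv => mul y x = one
  | RightInv => mul x y = one
  | TwoSidedInv => mul y x = one /\ mul x y = one
  end.

Section Sequences.
Context {R : realType} {A : banachAlgType R[i]}.
Implicit Types (f g : int -> A) (X : set (int -> A)).

(* The library norm on A takes its values in R[i] (where 0 <= `|a| means that
   `|a| is a nonnegative real); rnorm is the same number as an element of R. *)
Definition rnorm (a : A) : R := complex.Re `|a|.

Definition ellp (p : R) (w : int -> R) : set (int -> A) :=
  [set f | (\esum_(n in [set: int]) (rnorm (f n) `^ p * w n `^ p)%:E < +oo)%E].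

Definition ell1 : set (int -> A) := ellp 1 (fun=> 1).

Definition ell_union (p : nat -> R) (w : nat -> int -> R) : set (int -> A) :=
  \bigcup_n ellp (p n) (w n).

(* Sum over n >= 0 plus sum over n < 0 (Negz k is - k.+1). It is only
   meaningful, and only used, for absolutely convergent families. *)
Definition zsum (u : int -> A) : A :=
  limn (series (fun k : nat => u (Posz k)))
  + limn (series (fun k : nat => u (Negz k))).

Definition convz f g : int -> A := fun n => zsum (fun m => f (n - m) * g m).

Definition delta0 : int -> A := fun n => if n == 0 then (1 : A) else (0 : A).

Definition fourier f (z : R[i]) : A := zsum (fun n => z ^ n *: f n).

Definition subalgebra X : Prop :=
  [/\ X `<=` ell1,
      X delta0,
      forall f g, X f -> X g -> X (fun n => f n + g n),
      forall (c : R[i]) f, X f -> X (fun n => c *: f n)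
    & forall f g, X f -> X g -> X (convz f g)].

Definition typeII_algebra X : Prop :=
  subalgebra X /\
  exists (p : nat -> R) (w : nat -> int -> R),
    typeII_family p w /\ X = ell_union p w.

Definition inverse_closed X : Prop :=
  subalgebra X /\
  forall f, X f ->
    (exists2 g, ell1 g & is_inverse TwoSidedInv convz delta0 g f) ->
    exists2 g, X g & is_inverse TwoSidedInv convz delta0 g f.

End Sequences.

(* Main.v *)
(* For |z| = 1 let V = z^-1 U, where U is the unit mass at 1. A left inverse a of
   \hat f(z) gives, after a truncation of f and a Neumann series, an identity
   1 = b f + (1 - V) y in l^p(Z, A), and compactness of the circle bounds y
   uniformly in z. Iterating it, 1 = B f + (1 - V)^k y^k. Multiplied by the kernel
   (1 + V + ... + V^(M-1))^k and averaged over the (k M)-th roots of unity, the left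
   side becomes a multiple of a power of U, while (1 - V)^k turns into (1 - V^M)^k:
   for k p > 1 and M large this yields g with 1 - g f small in l^p.

   Truncate g to a finitely supported G. A weight nu <= w growing at most like
   C beta^|x|, with beta close to 1, is equivalent to a weight that is at most
   beta^|x|, hence close to 1 on any given finite set; in the corresponding
   quasi-norm 1 - G f is still small, so that G f is invertible in l^p_nu.

   For every weight w, the weights w^(1/k) grow this slowly when k is large, and
   they are constant, or admissible, exactly when w is. *)
Require Import Defs.
From HB Require Import structures.
From mathcomp Require Import all_boot all_order all_algebra.
From mathcomp Require Import complex.
From mathcomp Require Import all_classical all_reals all_analysis.
From mathcomp Require Import ring lra zify.
Set Implicit Arguments.
Unset Strict Implicit.
Unset Printing Implicit Defensive.
Import Order.TTheory GRing.Theory Num.Theory.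
Import numFieldNormedType.Exports.
Local Open Scope classical_set_scope.
Local Open Scope ring_scope.
Local Open Scope complex_scope.

(** Two obstacles shape the argument. As [A] is not commutative, no characters detect invertibility,
    and one-sided inverses are not unique, so those chosen at different points of the circle need
    not fit together. Averaging glues them all the same: U is central and f stays the rightmost
    factor, so an average of left multiples of f is again a left multiple of f. Secondly, for p < 1
    only p-th powers of quasi-norms can be added. An average over k M roots of unity therefore costs
    the full factor k M, while the normalization, by a number at least M^k, gains only M^(-k p).
    With k = 1 this would not tend to 0, hence the power of 1 - V.

    Only the space that contains f restricts the growth of the weights. The exponent 1/k is chosen
    for that one index and then shared by the whole family, which keeps the family decreasing. In
    the final equivalence, the extended GRS condition makes some [w n] itself slow enough; the
    converse rests on an explicit geometric series. *)

Lemma ler_sum_mem (R : realType) (I : eqType) (s : seq I) (F G : I -> R) :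
  (forall x, x \in s -> F x <= G x) ->
  \sum_(x <- s) F x <= \sum_(x <- s) G x.
Proof. by move=> h; rewrite big_seq [leRHS]big_seq; apply: ler_sum. Qed.

(** * Bounded partial sums *)

Section BoundedSums.
Context {R : realType} {I : eqType}.
Implicit Types (phi psi : I -> R) (c d : R) (s : seq I).

(** For a nonnegative family this says that its sum is at most [c], without an order of summation or
    extended reals; [ellpP] relates it to the sums that define the spaces. *)
Definition sums_le phi c := forall s, uniq s -> \sum_(x <- s) phi x <= c.

Lemma sums_le_ge0 phi c : sums_le phi c -> 0 <= c.
Proof. by move=> /(_ [::] isT); rewrite big_nil. Qed.

Lemma sums_le_le phi c d : c <= d -> sums_le phi c -> sums_le phi d.
Proof. by move=> cd h s us; apply: le_trans cd; apply: h. Qed.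

Lemma sums_le_mono phi psi c : (forall x, psi x <= phi x) -> sums_le phi c ->
  sums_le psi c.
Proof. by move=> le h s us; apply: le_trans (h s us); apply: ler_sum. Qed.

Lemma sbdD phi psi c d : sums_le phi c -> sums_le psi d ->
  sums_le (fun x => phi x + psi x) (c + d).
Proof. by move=> h k s us; rewrite big_split lerD ?h ?k. Qed.

Lemma sbdZ phi c k : 0 <= k -> sums_le phi c -> sums_le (fun x => k * phi x) (k * c).
Proof. by move=> k0 h s us; rewrite -mulr_sumr ler_wpM2l// h. Qed.

Lemma sums_le_pt phi c x : sums_le phi c -> phi x <= c.
Proof. by move=> /(_ [:: x] isT); rewrite big_seq1. Qed.

Lemma sums_le_pw phi psi c d : (forall x, 0 <= phi x) ->
  (forall x, psi x <= d) -> 0 <= d ->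
  sums_le phi c -> sums_le (fun x => psi x * phi x) (d * c).
Proof.
move=> phi0 pd d0 h; apply: (@sums_le_mono (fun x => d * phi x)); last exact: sbdZ.
by move=> x; apply: ler_wpM2r.
Qed.

Lemma sums_le_finite phi s : (forall x, 0 <= phi x) ->
  sums_le (fun x => if x \in s then phi x else 0) (\sum_(x <- undup s) phi x).
Proof.
move=> phi0 t ut; rewrite -big_mkcond -big_filter /=.
apply: (@le_trans _ _ (\sum_(x <- [seq x <- undup s | x \in t]) phi x)); last first.
  rewrite big_filter big_mkcond /=; apply: ler_sum => x _.
  by case: ifP.
rewrite le_eqVlt; apply/orP; left; apply/eqP/perm_big; apply: uniq_perm;
  rewrite ?filter_uniq ?undup_uniq// => x.
by rewrite !mem_filter mem_undup andbC.
Qed.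

(** The set [s] is one whose partial sum comes within [eta] of the supremum: a finite set disjoint
    from it can add at most [eta]. *)
Lemma sums_le_tail phi c eta : (forall x, 0 <= phi x) -> sums_le phi c -> 0 < eta ->
  exists2 s, uniq s & sums_le (fun x => if x \in s then 0 else phi x) eta.
Proof.
move=> phi0 h eta0.
pose S : set R := [set \sum_(x <- s) phi x | s in [set s : seq I | uniq s]].
have hS : has_sup S.
  split; first by exists (\sum_(x <- [::]) phi x); exists [::].
  by exists c => _ [s us <-]; apply: h.
have [_ [s us <-] ls] := sup_adherent eta0 hS.
exists s => // t ut.
have -> : \sum_(x <- t) (if x \in s then 0 else phi x) =
    \sum_(x <- [seq x <- t | x \notin s]) phi x.
  by rewrite big_filter [RHS]big_mkcond; apply: eq_bigr => x _; case: ifP.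
set t' := [seq x <- t | _].
have ust : uniq (s ++ t').
  rewrite cat_uniq us filter_uniq// andbT; apply/hasPn => x.
  by rewrite mem_filter => /andP[].
have /(sup_upper_bound hS) : S (\sum_(x <- s ++ t') phi x) by exists (s ++ t').
rewrite big_cat /=; lra.
Qed.

End BoundedSums.

Lemma sums_le_inj (R : realType) (I J : eqType) (phi : I -> R) c (h : J -> I) :
  injective h -> sums_le phi c -> sums_le (phi \o h) c.
Proof.
move=> hI H s us.
have -> : \sum_(x <- s) (phi \o h) x = \sum_(x <- map h s) phi x by rewrite big_map.
by apply: H; rewrite map_inj_uniq.
Qed.

(** * Subadditivity of p-th powers for p at most 1 *)

Section PowR.
Context {R : realType}.
Implicit Types (a b p : R).

(* Concavity of the p-th power, from a/(a+b) <= (a/(a+b))^p. *)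
Lemma powR_subadd p a b : 0 < p <= 1 -> 0 <= a -> 0 <= b ->
  (a + b) `^ p <= a `^ p + b `^ p.
Proof.
move=> /andP[p0 p1] a0 b0.
have [ab0|ab0] := eqVneq (a + b) 0.
  have a00 : a = 0 by lra. have b00 : b = 0 by lra.
  by rewrite a00 b00 addr0 powR0 ?gt_eqF// addr0.
have abp : 0 < a + b by rewrite lt_neqAle eq_sym ab0 addr_ge0.
have key x : 0 <= x -> x <= a + b -> x / (a + b) * (a + b) `^ p <= x `^ p.
  move=> x0 xab.
  have t0 : 0 <= x / (a + b) by rewrite divr_ge0 // ltW.
  have -> : x `^ p = (x / (a + b)) `^ p * (a + b) `^ p.
    by rewrite -powRM ?(ltW abp)// divfK// gt_eqF.
  rewrite ler_wpM2r ?powR_ge0//.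
  have [->|tn0] := eqVneq (x / (a + b)) 0; first exact: powR_ge0.
  rewrite -{1}[x / (a + b)]powRr1//.
  have tp : 0 < x / (a + b) by rewrite lt_neqAle eq_sym tn0.
  rewrite ger_powR// tp /= ler_pdivrMr// mul1r//.
have := lerD (key a a0 _) (key b b0 _); rewrite -mulrDl -mulrDl divff ?gt_eqF// mul1r.
by apply; lra.
Qed.

Lemma powR_sum_le p (I : Type) (s : seq I) (F : I -> R) : 0 < p <= 1 ->
  (forall i, 0 <= F i) -> (\sum_(i <- s) F i) `^ p <= \sum_(i <- s) F i `^ p.
Proof.
move=> p01 F0; elim: s => [|i s IH].
  by rewrite !big_nil powR0 // gt_eqF//; case/andP: p01.
rewrite !big_cons; apply: le_trans (powR_subadd p01 _ _) _ => //.
  exact: sumr_ge0.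
by rewrite lerD2l.
Qed.

Lemma powR_ge1 a p : 0 <= p -> 1 <= a -> 1 <= a `^ p.
Proof.
move=> p0 a1; have <- : 1 `^ p = 1 :> R by rewrite powR1.
rewrite ge0_ler_powR ?nnegrE//.
exact: le_trans a1.
Qed.

End PowR.

Lemma powR_expr (R : realType) (x r : R) k : 0 <= x -> (x ^+ k) `^ r = (x `^ r) ^+ k.
Proof.
by move=> x0; rewrite -[x ^+ k]powR_mulrn// -powRrM mulrC powRrM powR_mulrn ?powR_ge0.
Qed.

(** * The norm of [A] as a real number *)

Section Rnorm.
Context {R : realType} {A : banachAlgType R[i]}.
Implicit Types (a b : A) (f g u : int -> A).

Lemma rnormE a : `|a| = (rnorm a)%:C.
Proof.
rewrite /rnorm; have : 0 <= `|a| by [].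
by case: `|a| => x y /=; rewrite lecE /= => /andP[/eqP -> _].
Qed.

Lemma rnorm_ge0 a : 0 <= rnorm a.
Proof. by have := normr_ge0 a; rewrite rnormE lecR. Qed.

Lemma rnorm0 : rnorm (0 : A) = 0.
Proof. by rewrite /rnorm normr0. Qed.

Lemma rnormD a b : rnorm (a + b) <= rnorm a + rnorm b.
Proof. by have := ler_normD a b; rewrite !rnormE -rmorphD lecR. Qed.

Lemma rnormN a : rnorm (- a) = rnorm a.
Proof. by rewrite /rnorm normrN. Qed.

Lemma rnormM a b : rnorm (a * b) <= rnorm a * rnorm b.
Proof. by have := bnormM_le a b; rewrite !rnormE -rmorphM lecR. Qed.

Definition cabs (z : R[i]) : R := complex.Re `|z|.

Lemma cabsE z : `|z| = (cabs z)%:C.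
Proof. by []. Qed.

Lemma cabs_ge0 z : 0 <= cabs z.
Proof. by have := normr_ge0 z; rewrite cabsE lecR. Qed.

Lemma cabsM z1 z2 : cabs (z1 * z2) = cabs z1 * cabs z2.
Proof.
have := normrM z1 z2; rewrite !cabsE -rmorphM => /(congr1 (@complex.Re R)).
by [].
Qed.

Lemma rnormZ z a : rnorm (z *: a) = cabs z * rnorm a.
Proof. by rewrite /rnorm normrZ rnormE cabsE -rmorphM. Qed.

Lemma rnorm_eq0 a : rnorm a = 0 -> a = 0.
Proof. by move=> h; apply/normr0_eq0; rewrite rnormE h. Qed.

Lemma rnorm_le0 a : (forall e, 0 < e -> rnorm a <= e) -> a = 0.
Proof.
move=> h; apply: rnorm_eq0; apply/eqP; rewrite eq_le rnorm_ge0 andbT.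
apply/ler_addgt0Pl => e e0; rewrite addr0; exact: h.
Qed.

Lemma rnorm_sum (I : Type) (s : seq I) (F : I -> A) :
  rnorm (\sum_(i <- s) F i) <= \sum_(i <- s) rnorm (F i).
Proof.
elim: s => [|i s IH]; first by rewrite !big_nil rnorm0.
by rewrite !big_cons; apply: le_trans (rnormD _ _) _; rewrite lerD2l.
Qed.

Lemma cvg_rnorm (x : nat -> A) (l : A) : x @ \oo --> l ->
  forall e : R, 0 < e -> \forall n \near \oo, rnorm (l - x n) <= e.
Proof.
move=> /cvgrPdist_le h e e0; have := h e%:C; rewrite ltcR => /(_ e0).
by apply: filterS => n; rewrite rnormE lecR.
Qed.

Lemma rnorm_cauchy (x : nat -> A) :
  (forall e : R, 0 < e -> exists N, forall m n, (N <= m)%N -> (N <= n)%N ->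
    rnorm (x m - x n) <= e) -> cvgn x.
Proof.
move=> h; apply: cauchy_cvg; apply/cauchy_ballP => e e0.
have [e' e'0 ->] : exists2 e' : R, 0 < e' & e = e'%:C.
  by move: e0; case: e => a b; rewrite ltcE /= => /andP[/eqP -> a0]; exists a.
have e2 : 0 < e' / 2 by rewrite divr_gt0.
have [N hN] := h _ e2.
exists (x @` [set n | (N <= n)%N], x @` [set n | (N <= n)%N]) => /=.
  by split; exists N => // n /= Nn; exists n.
move=> [_ _] /= [[m Nm <-] [n Nn <-]]; rewrite -ball_normE /ball_ /= rnormE ltcR.
by apply: le_lt_trans (hN _ _ Nm Nn) _; lra.
Qed.

End Rnorm.

(** * Sums over the integers and convolution *)

Section Zsum.
Context {R : realType} {A : banachAlgType R[i]}.
Implicit Types (a b : A) (f g u v : int -> A).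

Definition abs_summable u := exists c : R, sums_le (fun x => rnorm (u x)) c.

Lemma series_cvg (v : nat -> A) (c : R) : sums_le (fun n => rnorm (v n)) c ->
  cvgn (series v).
Proof.
move=> h; apply: rnorm_cauchy => e e0.
have [s us hs] := sums_le_tail (fun x => rnorm_ge0 (v x)) h e0.
have [N hN] : exists N, forall x, x \in s -> (x < N)%N.
  exists (\max_(x <- s) x).+1 => x xs; rewrite ltnS.
  by apply: (@leq_bigmax_seq _ s xpredT (fun x => x)).
have key m n : (N <= n)%N -> (n <= m)%N -> rnorm (series v m - series v n) <= e.
  move=> Nn nm; rewrite sub_series nm; apply: le_trans (rnorm_sum _ _) _.
  apply: le_trans (hs (index_iota n m) (iota_uniq _ _)); apply: ler_sum_mem => x.
  rewrite mem_index_iota => /andP[nx _]; case: ifP => // /hN.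
  by rewrite ltnNge (leq_trans Nn nx).
exists N => m n Nm Nn; case: (leqP n m) => [nm|/ltnW mn]; first exact: key.
by rewrite -opprB rnormN; apply: key.
Qed.

(** The integers from -n to n - 1, arranged so that a sum over the window is the sum of the n-th
    partial sums of the two series in [zsum]. *)
Definition window (n : nat) : seq int :=
  [seq Posz k | k <- iota 0 n] ++ [seq Negz k | k <- iota 0 n].

Lemma mem_window n (x : int) :
  (x \in window n) = match x with Posz k => k < n | Negz k => k < n end%N.
Proof.
rewrite mem_cat; case: x => k.
  rewrite mem_map; last by move=> ? ? [].
  rewrite mem_iota add0n /= orbC; case: mapP => // -[] ? _ //.
rewrite orbC mem_map; last by move=> ? ? [].
by rewrite mem_iota add0n /= orbC; case: mapP => // -[] ? _ //.
Qed.

Lemma window_uniq n : uniq (window n).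
Proof.
rewrite cat_uniq !map_inj_uniq ?iota_uniq ?andbT; try by move=> ? ? [].
by apply/hasPn => _ /mapP[k _ ->]; apply/mapP => -[].
Qed.

Lemma near_window (s : seq int) : \forall n \near \oo, {subset s <= window n}.
Proof.
elim: s => [|x s IH]; first by near=> n.
have hx : \forall n \near \oo, x \in window n.
  case: x => k; exists k.+1 => // n /= kn; rewrite mem_window; exact: kn.
near=> n => y; rewrite inE => /orP[/eqP->|]; first by near: n.
by move: y; near: n; exact: IH.
Unshelve. all: by end_near. Qed.

Lemma sum_window u n : \sum_(x <- window n) u x =
  series (fun k : nat => u (Posz k)) n + series (fun k : nat => u (Negz k)) n.
Proof. by rewrite big_cat !big_map /series /= /index_iota subn0. Qed.

Lemma zsum_window u : abs_summable u -> forall e : R, 0 < e ->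
  \forall n \near \oo, rnorm (zsum u - \sum_(x <- window n) u x) <= e.
Proof.
move=> [c hc] e e0; have e2 : 0 < e / 2 by rewrite divr_gt0.
have cP : cvgn (series (fun k : nat => u (Posz k))).
  by apply: (series_cvg (c := c)); apply: (sums_le_inj (h := Posz)) hc => ? ? [].
have cN : cvgn (series (fun k : nat => u (Negz k))).
  by apply: (series_cvg (c := c)); apply: (sums_le_inj (h := Negz)) hc => ? ? [].
have hP := cvg_rnorm cP e2; have hN := cvg_rnorm cN e2.
near=> n; rewrite sum_window /zsum opprD addrACA.
apply: le_trans (rnormD _ _) _; rewrite [e]splitr.
by apply: lerD; near: n.
Unshelve. all: by end_near. Qed.

Lemma zsum_uniq u l : abs_summable u -> (forall e : R, 0 < e ->
   \forall n \near \oo, rnorm (l - \sum_(x <- window n) u x) <= e) -> zsum u = l.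
Proof.
move=> su h; apply/eqP; rewrite -subr_eq0; apply/eqP/rnorm_le0 => e e0.
have e2 : 0 < e / 2 by rewrite divr_gt0.
have [n [h1 h2]] := filter_ex (filterI (zsum_window su e2) (h _ e2)).
rewrite -(subrK (\sum_(x <- window n) u x) (zsum u)) -addrA.
apply: le_trans (rnormD _ _) _; rewrite [e]splitr lerD//.
by rewrite -rnormN opprB.
Qed.

Lemma abs_summable_lin u (L : A -> A) (K : R) : abs_summable u -> 0 <= K ->
  (forall a, rnorm (L a) <= K * rnorm a) -> abs_summable (fun x => L (u x)).
Proof.
move=> [c hc] K0 hL; exists (K * c).
by apply: (sums_le_mono _ (sbdZ K0 hc)) => x; exact: hL.
Qed.

(** Stated for bounded additive maps in order to cover both left multiplication by an element of [A]
    and scalar multiplication. *)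
Lemma zsum_lin u (L : A -> A) (K : R) : abs_summable u -> 0 <= K ->
  (forall a b, L (a + b) = L a + L b) -> (forall a, rnorm (L a) <= K * rnorm a) ->
  zsum (fun x => L (u x)) = L (zsum u).
Proof.
move=> su K0 LD LK; apply: zsum_uniq; first exact: abs_summable_lin su K0 LK.
have L0 : L 0 = 0 by apply: (addrI (L 0)); rewrite -LD !addr0.
have LN a : L (- a) = - L a by apply: (addrI (L a)); rewrite -LD !subrr.
have LS s : \sum_(x <- s) L (u x) = L (\sum_(x <- s) u x).
  by elim: s => [|x s IH]; rewrite ?big_nil // !big_cons LD IH.
move=> e e0; have e1 : 0 < e / (K + 1) by rewrite divr_gt0// ltr_wpDl.
near=> n; rewrite LS -LN -LD; apply: le_trans (LK _) _.
apply: (@le_trans _ _ (K * (e / (K + 1)))).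
  by rewrite ler_wpM2l//; near: n; exact: zsum_window.
rewrite mulrCA ler_piMr ?(ltW e0)// ler_pdivrMr ?ltr_wpDl//; lra.
Unshelve. all: by end_near. Qed.

Lemma abs_summableD u v : abs_summable u -> abs_summable v ->
  abs_summable (fun x => u x + v x).
Proof.
move=> [c hc] [d hd]; exists (c + d); apply: (sums_le_mono _ (sbdD hc hd)) => x.
exact: rnormD.
Qed.

Lemma zsumD u v : abs_summable u -> abs_summable v ->
  zsum (fun x => u x + v x) = zsum u + zsum v.
Proof.
move=> su sv; apply: zsum_uniq; first exact: abs_summableD.
move=> e e0; have e2 : 0 < e / 2 by rewrite divr_gt0.
near=> n; rewrite big_split /= opprD addrACA.
apply: le_trans (rnormD _ _) _; rewrite [e]splitr.
by apply: lerD; near: n; exact: zsum_window.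
Unshelve. all: by end_near. Qed.

Lemma abs_summable1 u i : (forall x, x != i -> u x = 0) -> abs_summable u.
Proof.
move=> h; exists (\sum_(x <- undup [:: i]) rnorm (u x)).
apply: sums_le_mono (sums_le_finite _ (fun x => rnorm_ge0 (u x))) => x.
by rewrite inE; case: eqP => // /eqP/h->; rewrite rnorm0.
Qed.

Lemma zsum1 u i : (forall x, x != i -> u x = 0) -> zsum u = u i.
Proof.
move=> h; apply: zsum_uniq; first exact: abs_summable1 h.
move=> e e0; near=> n.
have iw : i \in window n by near: n; have := near_window [:: i];
  apply: filterS => n; apply; rewrite inE.
rewrite (bigD1_seq i)//= ?window_uniq// big1 ?addr0 ?subrr ?rnorm0 ?ltW//.
Unshelve. all: by end_near. Qed.

(** The p-triangle inequality for infinite sums. The error [e] allows a finite window on the right,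
    so that later double sums are finite; the window is large enough to leave at most e^(1/p)
    outside. *)
Lemma zsum_pow (p : R) u : 0 < p <= 1 -> abs_summable u -> forall e : R, 0 < e ->
  \forall n \near \oo,
    rnorm (zsum u) `^ p <= \sum_(x <- window n) rnorm (u x) `^ p + e.
Proof.
move=> p01 su e e0; have /andP[p0 _] := p01.
have e1 : 0 < e `^ p^-1 by rewrite powR_gt0.
near=> n.
apply: (@le_trans _ _ ((\sum_(x <- window n) rnorm (u x) + e `^ p^-1) `^ p)).
  rewrite ge0_ler_powR ?nnegrE ?(ltW p0)// ?rnorm_ge0//.
    by rewrite addr_ge0 ?powR_ge0// sumr_ge0// => x _; exact: rnorm_ge0.
  rewrite -{1}(subrK (\sum_(x <- window n) u x) (zsum u)) addrC.
  apply: le_trans (rnormD _ _) _; apply: lerD; first exact: rnorm_sum.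
  by near: n; exact: zsum_window.
apply: le_trans (powR_subadd p01 _ _) _; rewrite ?powR_ge0//.
  by rewrite sumr_ge0// => x _; exact: rnorm_ge0.
rewrite -powRrM mulVf ?gt_eqF// powRr1 ?(ltW e0)// lerD2r.
by apply: powR_sum_le => // x; exact: rnorm_ge0.
Unshelve. all: by end_near. Qed.

Lemma zsum_le u (c : R) : sums_le (fun x => rnorm (u x)) c -> rnorm (zsum u) <= c.
Proof.
move=> h; have p1 : 0 < (1 : R) <= 1 by rewrite ltr01 lexx.
apply/ler_addgt0Pr => e e0.
have su : abs_summable u by exists c.
have [n] := filter_ex (zsum_pow p1 su e0).
rewrite powRr1 ?rnorm_ge0// => hn; apply: le_trans hn _; rewrite lerD2r.
under eq_bigr do rewrite powRr1 ?rnorm_ge0//.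
exact: h (window_uniq n).
Qed.

End Zsum.

(** * Weighted p-th powers under convolution *)

Section Lp.
Context {R : realType} {A : banachAlgType R[i]}.
Implicit Types (a b : A) (f g u v : int -> A) (p c d : R) (w : int -> R).

Definition wpow p w f (x : int) : R := rnorm (f x) `^ p * w x `^ p.

Lemma wpow_ge0 p w f x : 0 <= wpow p w f x.
Proof. by rewrite mulr_ge0 ?powR_ge0. Qed.

Lemma wpow_rnorm p w f c : 0 < p <= 1 -> (forall x, 1 <= w x) ->
  sums_le (wpow p w f) c -> sums_le (fun x => rnorm (f x)) (c `^ p^-1).
Proof.
move=> p01 w1 h; have /andP[p0 _] := p01; move=> s us.
have s0 : 0 <= \sum_(x <- s) rnorm (f x).
  by rewrite sumr_ge0// => x _; exact: rnorm_ge0.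
rewrite -[leLHS]powRr1// -(@mulfV _ p) ?gt_eqF// powRrM.
rewrite ge0_ler_powR ?nnegrE ?invr_ge0 ?powR_ge0 ?(ltW p0)//;
  first exact: sums_le_ge0 h.
apply: le_trans (powR_sum_le _ p01 (fun x => rnorm_ge0 (f x))) _.
apply: le_trans (h s us); apply: ler_sum => x _.
by rewrite ler_peMr ?powR_ge0// powR_ge1// ?w1// ltW.
Qed.

Lemma convz_terms_summable f g n : abs_summable f -> abs_summable g ->
  abs_summable (fun m => f (n - m) * g m).
Proof.
move=> [c hc] [d hd]; exists (c * d).
apply: (@sums_le_mono _ _ (fun x => rnorm (f (n - x)) * rnorm (g x))).
  by move=> x; exact: rnormM.
apply: sums_le_pw => // [x|x|]; first exact: rnorm_ge0.
  exact: (sums_le_pt (n - x) hc).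
exact: sums_le_ge0 hc.
Qed.

Lemma near_all_seq (I : eqType) (s : seq I) (P : I -> nat -> Prop) :
  (forall x, \forall n \near \oo, P x n) ->
  \forall n \near \oo, forall x, x \in s -> P x n.
Proof.
move=> h; elim: s => [|x s IH]; first by near=> n.
near=> n => y; rewrite inE => /orP[/eqP->|]; first by near: n.
by move: y; near: n.
Unshelve. all: by end_near. Qed.

(** As p is at most 1, the p-th power passes inside the convolution, and [w x <= w (x - m) * w m]
    splits the weight. Exchanging two finite sums gives [c * d]. *)
Lemma convz_wpow p w f g c d : 0 < p <= 1 -> (forall x, 1 <= w x) ->
  (forall x y, w (x + y) <= w x * w y) -> abs_summable f -> abs_summable g ->
  sums_le (wpow p w f) c -> sums_le (wpow p w g) d ->
    sums_le (wpow p w (convz f g)) (c * d).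
Proof.
move=> p01 w1 wM sf sg hf hg s us; have /andP[p0 p1] := p01.
have w0 x : 0 <= w x by apply: le_trans (w1 x).
have c0 := sums_le_ge0 hf.
apply/ler_addgt0Pr => e e0.
set W := \sum_(x <- s) w x `^ p.
have W0 : 0 <= W by apply: sumr_ge0 => x _; exact: powR_ge0.
(* Multiplied by the weights over [s], this error adds up to at most [e]; as [s] is finite, one
   window serves all its points. *)
have e1 : 0 < e / (W + 1) by rewrite divr_gt0// ltr_wpDl.
have := near_all_seq s (fun x => zsum_pow p01 (convz_terms_summable x sf sg) e1).
move=> /filter_ex[n hn].
apply: (@le_trans _ _ (\sum_(x <- s) \sum_(m <- window n) wpow p w f (x - m) * wpow p w g m
   + (\sum_(x <- s) w x `^ p) * (e / (W + 1)))).
  rewrite mulr_suml -big_split /=; apply: ler_sum_mem => x xs.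
  rewrite {1}/wpow; apply: le_trans (ler_wpM2r (powR_ge0 _ _) (hn _ xs)) _.
  rewrite mulrDl [e / _ * _]mulrC lerD2r mulr_suml; apply: ler_sum => m _.
  rewrite /wpow [leRHS]mulrACA -[X in _ <= X * _]powRM ?rnorm_ge0//.
  rewrite -[X in _ <= _ * X]powRM//.
  apply: ler_pM; rewrite ?powR_ge0//.
    by rewrite ge0_ler_powR ?nnegrE ?mulr_ge0 ?rnorm_ge0 ?(ltW p0)// rnormM.
  by rewrite ge0_ler_powR ?nnegrE ?mulr_ge0 ?(ltW p0)// -{1}(subrK m x).
apply: lerD.
  rewrite exchange_big /=.
  apply: (@le_trans _ _ (\sum_(m <- window n) c * wpow p w g m)).
    apply: ler_sum => m _; rewrite -mulr_suml ler_wpM2r ?wpow_ge0//.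
    by apply: (sums_le_inj (h := fun x => x - m)) hf _ us; exact: addIr.
  by rewrite -mulr_sumr ler_wpM2l// hg// window_uniq.
rewrite -/W mulrCA ler_piMr ?(ltW e0)// ler_pdivrMr ?ltr_wpDl//; lra.
Qed.

End Lp.

Section Convolution.
Context {R : realType} {A : banachAlgType R[i]}.
Implicit Types (a b : A) (f g h u v : int -> A) (p c d : R) (w : int -> R).

Lemma wpow11 f : wpow 1 (fun=> 1) f = fun x => rnorm (f x).
Proof.
by apply/funext => x; rewrite /wpow powR1 mulr1 powRr1 ?rnorm_ge0.
Qed.

Lemma convz_sums_le f g c d : sums_le (fun x => rnorm (f x)) c ->
  sums_le (fun x => rnorm (g x)) d -> sums_le (fun x => rnorm (convz f g x)) (c * d).
Proof.
move=> hf hg; have := @convz_wpow R A 1 (fun=> 1) f g c d.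
rewrite !wpow11; apply=> //; rewrite ?ltr01 ?lexx// ?mulr1//;
  by [exists c | exists d].
Qed.

Lemma convz_summable f g : abs_summable f -> abs_summable g ->
  abs_summable (convz f g).
Proof. by move=> [c hc] [d hd]; exists (c * d); exact: convz_sums_le. Qed.

Definition atom (i : int) a : int -> A := fun x => if x == i then a else 0.

Definition trunc (s : seq int) u : int -> A := fun x => if x \in s then u x else 0.

Lemma atom_summable i a : abs_summable (atom i a).
Proof. by apply: (@abs_summable1 _ _ _ i) => x /negPf; rewrite /atom => ->. Qed.

Lemma sums_le_atom i a : sums_le (fun x => rnorm (atom i a x)) (rnorm a).
Proof.
have := sums_le_finite [:: i] (fun x => rnorm_ge0 (atom i a x)).
rewrite /= big_seq1 {2}/atom eqxx; apply: sums_le_mono => x.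
by rewrite inE /atom; case: eqP; rewrite ?rnorm0.
Qed.

Lemma trunc_cons i s u : i \notin s ->
  trunc (i :: s) u = (fun x => atom i (u i) x + trunc s u x).
Proof.
move=> is_; apply/funext => x; rewrite /trunc /atom inE.
by case: eqP => [->|_]; rewrite ?(negPf is_) ?addr0 ?add0r.
Qed.

Lemma trunc_summable s u : abs_summable (trunc s u).
Proof.
exists (\sum_(x <- undup s) rnorm (u x)).
apply: sums_le_mono (sums_le_finite s (fun x => rnorm_ge0 (u x))) => x.
by rewrite /trunc; case: ifP; rewrite ?rnorm0.
Qed.

Lemma trunc_tail s u x : u x - trunc s u x = if x \in s then 0 else u x.
Proof. by rewrite /trunc; case: ifP; rewrite ?subrr ?subr0. Qed.

(** Finitely supported families are dense in l^1, so an identity between bounded additive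
    expressions only has to be checked on atoms. This takes the place of exchanging double
    series. *)
Lemma l1_density (Phi : (int -> A) -> A) (K : R) :
  (forall u v, abs_summable u -> abs_summable v ->
    Phi (fun x => u x + v x) = Phi u + Phi v) ->
  (forall u c, sums_le (fun x => rnorm (u x)) c -> rnorm (Phi u) <= K * c) ->
  (forall i a, Phi (atom i a) = 0) ->
  forall u, abs_summable u -> Phi u = 0.
Proof.
move=> PD PK P1 u [c hc].
have P0 s : uniq s -> Phi (trunc s u) = 0.
  elim: s => [_|i s IH /= /andP[is_ us]].
    apply: rnorm_eq0; apply/eqP; rewrite eq_le rnorm_ge0 andbT.
    rewrite -(mulr0 K); apply: PK => s _; rewrite big1// => x _; exact: rnorm0.
  by rewrite trunc_cons// PD ?P1 ?IH ?addr0//;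
    [exact: atom_summable|exact: trunc_summable].
(* The bound is tested on the atom of 1, whose norm is positive. *)
have K0 : 0 <= K.
  have := PK (atom 0 1) _ (sums_le_atom 0 1).
  rewrite P1 rnorm0 pmulr_lge0// lt_neqAle rnorm_ge0 andbT eq_sym.
  by apply/eqP => /rnorm_eq0/eqP; rewrite oner_eq0.
apply: rnorm_le0 => e e0.
have e1 : 0 < e / (K + 1) by rewrite divr_gt0// ltr_wpDl.
have [s us hs] := sums_le_tail (fun x => rnorm_ge0 (u x)) hc e1.
pose v x := u x - trunc s u x.
have hv : sums_le (fun x => rnorm (v x)) (e / (K + 1)).
  apply: sums_le_mono hs => x; rewrite /v trunc_tail; case: ifP => //;
    by rewrite rnorm0.
have -> : u = (fun x => trunc s u x + v x).
  by apply/funext => x; rewrite /v addrC subrK.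
rewrite PD ?P0 ?add0r//; [|exact: trunc_summable|by exists (e / (K + 1))].
apply: le_trans (PK _ _ hv) _.
rewrite mulrCA ler_piMr ?(ltW e0)// ler_pdivrMr ?ltr_wpDl//; lra.
Qed.

Lemma convzDl f g h : abs_summable f -> abs_summable g -> abs_summable h ->
  convz (fun x => f x + g x) h = (fun x => convz f h x + convz g h x).
Proof.
move=> sf sg sh; apply/funext => n; rewrite /convz -zsumD;
  [|exact: convz_terms_summable..].
by congr zsum; apply/funext => m; rewrite mulrDl.
Qed.

Lemma convzDr f g h : abs_summable f -> abs_summable g -> abs_summable h ->
  convz f (fun x => g x + h x) = (fun x => convz f g x + convz f h x).
Proof.
move=> sf sg sh; apply/funext => n; rewrite /convz -zsumD;
  [|exact: convz_terms_summable..].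
by congr zsum; apply/funext => m; rewrite mulrDr.
Qed.

Lemma convz_atom f i a : convz (atom i a) f = fun n => a * f (n - i).
Proof.
apply/funext => n; rewrite /convz (@zsum1 _ _ _ (n - i)).
  by rewrite /atom subKr eqxx.
move=> m mi; rewrite /atom; case: eqP => [e|_]; last by rewrite mul0r.
by move/eqP: mi; rewrite -e subKr.
Qed.

Lemma convz_mull a f g : abs_summable f -> abs_summable g ->
  convz (fun x => a * f x) g = fun n => a * convz f g n.
Proof.
move=> sf sg; apply/funext => n; rewrite /convz.
rewrite -(@zsum_lin _ _ _ (fun b => a * b) (rnorm a)) ?rnorm_ge0//.
- by congr zsum; apply/funext => m; rewrite mulrA.
- exact: convz_terms_summable.
- by move=> ? ?; rewrite mulrDr.
- exact: rnormM.
Qed.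

Lemma rnormB a b : rnorm (a - b) <= rnorm a + rnorm b.
Proof. by apply: le_trans (rnormD _ _) _; rewrite rnormN. Qed.

(** By density [f] may be taken to be an atom; convolution with it is a translation and a left
    multiplication by a constant, which passes through the inner sum. *)
Lemma convzA f g h : abs_summable f -> abs_summable g -> abs_summable h ->
  convz f (convz g h) = convz (convz f g) h.
Proof.
move=> sf sg sh; apply/funext => n; apply/eqP; rewrite -subr_eq0; apply/eqP.
have [c hc] := sg; have [d hd] := sh.
apply: (@l1_density (fun u => convz u (convz g h) n - convz (convz u g) h n)
  (c * d + c * d)) sf.
- move=> u v su sv; rewrite (convzDl su sv sg) (convzDl su sv (convz_summable sg sh)).
  rewrite (convzDl (convz_summable su sg) (convz_summable sv sg) sh).
  by rewrite opprD addrACA.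
- move=> u k hu; apply: le_trans (rnormB _ _) _.
  rewrite mulrDl; apply: lerD; rewrite mulrC ?mulrA.
    by rewrite -mulrA; apply: (sums_le_pt n (convz_sums_le hu (convz_sums_le hc hd))).
  by apply: (sums_le_pt n (convz_sums_le (convz_sums_le hu hc) hd)).
move=> i a; rewrite !convz_atom convz_mull//; last first.
  by exists c; apply: (sums_le_inj (h := fun x => x - i)) hc; exact: addIr.
apply/eqP; rewrite subr_eq0; apply/eqP; congr (a * _).
by rewrite /convz; congr zsum; apply/funext => m; congr (g _ * _); ring.
Qed.

Lemma abs_summableZ (z : R[i]) f : abs_summable f -> abs_summable (fun x => z *: f x).
Proof.
move=> sf; apply: (abs_summable_lin sf (cabs_ge0 z)) => a; by rewrite rnormZ.
Qed.

Lemma zsum_scale (z : R[i]) f : abs_summable f ->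
  zsum (fun x => z *: f x) = z *: zsum f.
Proof.
move=> sf; apply: (zsum_lin (L := fun a => z *: a) sf (cabs_ge0 z)).
  by move=> ? ?; rewrite scalerDr.
by move=> a; rewrite rnormZ.
Qed.

Lemma convzZl (z : R[i]) f g : abs_summable f -> abs_summable g ->
  convz (fun x => z *: f x) g = fun x => z *: convz f g x.
Proof.
move=> sf sg; apply/funext => n; rewrite /convz -zsum_scale;
  last exact: convz_terms_summable.
by congr zsum; apply/funext => m; rewrite -scalerAl.
Qed.

Lemma convzZr (z : R[i]) f g : abs_summable f -> abs_summable g ->
  convz f (fun x => z *: g x) = fun x => z *: convz f g x.
Proof.
move=> sf sg; apply/funext => n; rewrite /convz -zsum_scale;
  last exact: convz_terms_summable.
by congr zsum; apply/funext => m; rewrite -scalerAr.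
Qed.

Lemma delta0E : delta0 = atom 0 1.
Proof. by []. Qed.

Lemma conv1z f : convz delta0 f = f.
Proof. by rewrite delta0E convz_atom; apply/funext => n; rewrite mul1r subr0. Qed.

Lemma convz1 f : convz f delta0 = f.
Proof.
apply/funext => n; rewrite /convz (@zsum1 _ _ _ 0) ?subr0.
  by rewrite /delta0 eqxx mulr1.
by move=> m /negPf m0; rewrite /delta0 m0 mulr0.
Qed.

End Convolution.

(** * The convolution algebra l^1(Z, A) *)

Record L1 (R : realType) (A : banachAlgType R[i]) :=
  MkL1 { l1v :> int -> A; l1P : abs_summable l1v }.

Section L1Ring.
Context {R : realType} {A : banachAlgType R[i]}.

(** By proof irrelevance the summability proof does not affect equality, so ring laws for the
    bundled type reduce to identities of functions. The bundling makes the general theory of powers,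
    finite sums and commuting elements available for convolution. *)
Lemma L1_eq (x y : L1 A) : (x : int -> A) = y -> x = y.
Proof.
case: x y => f hf [g hg] /= fg; rewrite fg in hf *.
by rewrite (Prop_irrelevance hf hg).
Qed.

HB.instance Definition _ := gen_eqMixin (L1 A).
HB.instance Definition _ := gen_choiceMixin (L1 A).

Lemma abs_summable0 : abs_summable (fun=> 0 : A).
Proof. by apply: (@abs_summable1 _ _ _ 0). Qed.

Lemma abs_summableN (f : int -> A) : abs_summable f -> abs_summable (fun x => - f x).
Proof. by move=> [c h]; exists c; apply: sums_le_mono h => x; rewrite rnormN. Qed.

Definition L1zero : L1 A := MkL1 abs_summable0.
Definition L1opp (x : L1 A) : L1 A := MkL1 (abs_summableN (l1P x)).
Definition L1add (x y : L1 A) : L1 A := MkL1 (abs_summableD (l1P x) (l1P y)).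
Definition L1one : L1 A := MkL1 (atom_summable 0 1).
Definition L1mul (x y : L1 A) : L1 A := MkL1 (convz_summable (l1P x) (l1P y)).
Definition L1scale (z : R[i]) (x : L1 A) : L1 A := MkL1 (abs_summableZ z (l1P x)).

Fact L1addA : associative L1add.
Proof. by move=> x y z; apply/L1_eq/funext => n /=; rewrite addrA. Qed.
Fact L1addC : commutative L1add.
Proof. by move=> x y; apply/L1_eq/funext => n /=; rewrite addrC. Qed.
Fact L1add0 : left_id L1zero L1add.
Proof. by move=> x; apply/L1_eq/funext => n /=; rewrite add0r. Qed.
Fact L1addN : left_inverse L1zero L1opp L1add.
Proof. by move=> x; apply/L1_eq/funext => n /=; rewrite addNr. Qed.

HB.instance Definition _ :=
  GRing.isZmodule.Build (L1 A) L1addA L1addC L1add0 L1addN.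

Fact L1mulA : associative L1mul.
Proof. by move=> x y z; apply/L1_eq; apply: convzA; exact: l1P. Qed.
Fact L1mul1x : left_id L1one L1mul.
Proof. by move=> x; apply/L1_eq; exact: conv1z. Qed.
Fact L1mulx1 : right_id L1one L1mul.
Proof. by move=> x; apply/L1_eq; exact: convz1. Qed.
Fact L1mulDl : left_distributive L1mul L1add.
Proof. by move=> x y z; apply/L1_eq; apply: convzDl; exact: l1P. Qed.
Fact L1mulDr : right_distributive L1mul L1add.
Proof. by move=> x y z; apply/L1_eq; apply: convzDr; exact: l1P. Qed.
Fact L1one_neq0 : L1one != 0.
Proof.
apply/eqP => /(congr1 (fun x : L1 A => x 0)) /= /eqP.
by rewrite /atom eqxx oner_eq0.
Qed.

HB.instance Definition _ := GRing.Zmodule_isNzRing.Build (L1 A)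
  L1mulA L1mul1x L1mulx1 L1mulDl L1mulDr L1one_neq0.

Fact L1scaleA (a b : R[i]) (x : L1 A) : L1scale a (L1scale b x) = L1scale (a * b) x.
Proof. by apply/L1_eq/funext => n /=; rewrite scalerA. Qed.
Fact L1scale1 : left_id 1 L1scale.
Proof. by move=> x; apply/L1_eq/funext => n /=; rewrite scale1r. Qed.
Fact L1scaleDr : right_distributive L1scale +%R.
Proof. by move=> a x y; apply/L1_eq/funext => n /=; rewrite scalerDr. Qed.
Fact L1scaleDl (x : L1 A) : {morph L1scale^~ x : a b / a + b}.
Proof. by move=> a b; apply/L1_eq/funext => n /=; rewrite scalerDl. Qed.

HB.instance Definition _ := GRing.Zmodule_isLmodule.Build R[i] (L1 A)
  L1scaleA L1scale1 L1scaleDr L1scaleDl.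

Fact L1scaleAl (z : R[i]) (x y : L1 A) : z *: (x * y) = (z *: x) * y.
Proof. by apply/L1_eq; rewrite /= convzZl//; exact: l1P. Qed.
Fact L1scaleAr (z : R[i]) (x y : L1 A) : z *: (x * y) = x * (z *: y).
Proof. by apply/L1_eq; rewrite /= convzZr//; exact: l1P. Qed.

HB.instance Definition _ := GRing.Lmodule_isLalgebra.Build R[i] (L1 A) L1scaleAl.
HB.instance Definition _ := GRing.Lalgebra_isAlgebra.Build R[i] (L1 A) L1scaleAr.

Lemma L1addE (x y : L1 A) n : (x + y) n = x n + y n. Proof. by []. Qed.
Lemma L1oppE (x : L1 A) n : (- x) n = - x n. Proof. by []. Qed.
Lemma L1mulE (x y : L1 A) : (x * y : L1 A) = convz x y :> (int -> A). Proof. by [].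
  Qed.
Lemma L1scaleE (z : R[i]) (x : L1 A) n : (z *: x) n = z *: x n. Proof. by []. Qed.

End L1Ring.

Lemma cvg0_small (R : realType) (e : nat -> R) d : e @ \oo --> 0 -> 0 < d ->
  exists N, forall n, (N <= n)%N -> e n <= d.
Proof.
move=> /cvgrPdist_le h /h[N _ hN]; exists N => n /hN /=.
by rewrite sub0r normrN; apply: le_trans; exact: ler_norm.
Qed.

(** * Weighted p-norms *)

Section Pnorm.
Context {R : realType} {A : banachAlgType R[i]}.
Variables (p : R) (w : int -> R).
Hypotheses (p01 : 0 < p <= 1) (ww : weight w).
Implicit Types (x y r : L1 A) (c d : R).

Let w1 k : 1 <= w k. Proof. by case: ww. Qed.
Let p0 : 0 < p. Proof. by case/andP: p01. Qed.

(* The p-th power of the weighted l^p quasi-norm of [x] is at most [c]; these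
   p-th powers are subadditive and submultiplicative. *)
Definition lp_le x c := sums_le (wpow p w x) c.

Lemma wpowD (f g : int ->
  A) k : wpow p w (fun n => f n + g n) k <= wpow p w f k + wpow p w g k.
Proof.
rewrite /wpow -mulrDl ler_wpM2r ?powR_ge0//.
apply: (@le_trans _ _ ((rnorm (f k) + rnorm (g k)) `^ p)).
  rewrite ge0_ler_powR ?nnegrE ?(ltW p0) ?addr_ge0 ?rnorm_ge0//.
  exact: rnormD.
by apply: powR_subadd p01 _ _; exact: rnorm_ge0.
Qed.

Lemma lp_le_ge0 x c : lp_le x c -> 0 <= c. Proof. exact: sums_le_ge0. Qed.

Lemma lp_le_trans x c d : c <= d -> lp_le x c -> lp_le x d. Proof.
  exact: sums_le_le. Qed.

Lemma lp_le0 : lp_le 0 0.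
Proof.
by move=> s _; rewrite big1// => k _; rewrite /wpow rnorm0 powR0 ?gt_eqF// mul0r.
Qed.

Lemma lp_leD x y c d : lp_le x c -> lp_le y d -> lp_le (x + y) (c + d).
Proof. by move=> hx hy; apply: sums_le_mono (sbdD hx hy) => k; exact: wpowD. Qed.

Lemma lp_leM x y c d : lp_le x c -> lp_le y d -> lp_le (x * y) (c * d).
Proof. by case: ww => ? ?; apply: convz_wpow => //; exact: l1P. Qed.

Lemma lp_leZ (z : R[i]) x c : lp_le x c -> lp_le (z *: x) (cabs z `^ p * c).
Proof.
move=> hx; apply: sums_le_mono (sbdZ (powR_ge0 _ _) hx) => k.
by rewrite /wpow L1scaleE rnormZ powRM ?cabs_ge0 ?rnorm_ge0// mulrA.
Qed.

Lemma lp_leN x c : lp_le x c -> lp_le (- x) c.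
Proof. by move=> hx; apply: sums_le_mono hx => k; rewrite /wpow L1oppE rnormN. Qed.

Lemma lp_leB x y c d : lp_le x c -> lp_le y d -> lp_le (x - y) (c + d).
Proof. by move=> hx hy; apply: lp_leD => //; exact: lp_leN. Qed.

Lemma lp_le_sum (I : Type) (s : seq I) (F : I -> L1 A) (c : I -> R) :
  (forall i, lp_le (F i) (c i)) -> lp_le (\sum_(i <- s) F i) (\sum_(i <- s) c i).
Proof.
move=> h; elim: s => [|i s IH]; first by rewrite !big_nil; exact: lp_le0.
by rewrite !big_cons; exact: lp_leD.
Qed.

Definition L1atom (i : int) (a : A) : L1 A := MkL1 (atom_summable i a).

Lemma lp_le_atom i a : lp_le (L1atom i a) (rnorm a `^ p * w i `^ p).
Proof.
have := sums_le_finite [:: i] (wpow_ge0 p w (L1atom i a)).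
rewrite /= big_seq1 {2}/wpow /= {2}/atom eqxx; apply: sums_le_mono => k.
rewrite inE /wpow /= /atom; case: eqP => //.
by rewrite rnorm0 powR0 ?gt_eqF// mul0r.
Qed.

(** The p-th power of the quasi-norm of the unit, kept as a constant because neither the norm of
    [1 : A] nor [w 0] has to be 1. *)
Definition unit_pnorm : R := rnorm (1 : A) `^ p * w 0 `^ p.

Lemma lp_le1 : lp_le 1 unit_pnorm.
Proof. exact: lp_le_atom. Qed.

Lemma rnorm_lp_le (f : int -> A) k (e c : R) : 0 < e -> c <= e `^ p ->
  sums_le (wpow p w f) c -> rnorm (f k) <= e.
Proof.
move=> e0 ce h.
have : rnorm (f k) `^ p <= e `^ p.
  apply: le_trans (le_trans (sums_le_pt k h) ce); rewrite /wpow.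
  by rewrite ler_peMr ?powR_ge0// powR_ge1// ltW.
move=> /(@ge0_ler_powR _ p^-1); rewrite !nnegrE !powR_ge0 invr_ge0 (ltW p0).
rewrite -!powRrM mulfV ?gt_eqF// !powRr1 ?rnorm_ge0 ?(ltW e0)//.
exact.
Qed.

Lemma lp_eq0 x : (forall e, 0 < e -> lp_le x e) -> x = 0.
Proof.
move=> h; apply/L1_eq/funext => k; apply: rnorm_le0 => e e0.
by apply: (rnorm_lp_le k e0 (lexx _)); apply: h; rewrite powR_gt0.
Qed.

(** The limit is taken pointwise in [A]. The bounds survive because they concern finite partial
    sums, on each of which [x m] is close to the limit for some large [m]. *)
Lemma lp_complete (x : nat -> L1 A) (e : nat -> R) :
  (forall m n, (n <= m)%N -> lp_le (x m - x n) (e n)) -> e @ \oo --> 0 ->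
  exists l, forall n, lp_le (l - x n) (e n).
Proof.
move=> xe e0.
have cv k : cvgn (fun n => x n k).
  apply: rnorm_cauchy => d d0.
  have dp : 0 < d `^ p by rewrite powR_gt0.
  have [N hN] := cvg0_small e0 dp.
  have key m n : (N <= n)%N -> (n <= m)%N -> rnorm (x m k - x n k) <= d.
    move=> Nn nm; apply: (rnorm_lp_le (f := x m - x n) k d0 _ (xe _ _ nm)).
    exact: hN.
  exists N => m n Nm Nn; case: (leqP n m) => [nm|/ltnW mn]; first exact: key.
  by rewrite -opprB rnormN; apply: key.
pose l k := limn (fun n => x n k).
have hl n : sums_le (wpow p w (fun k => l k - x n k)) (e n).
  move=> s us; apply/ler_addgt0Pr => d d0.
  set W := \sum_(k <- s) w k `^ p.
  have W0 : 0 <= W by apply: sumr_ge0 => k _; exact: powR_ge0.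
  have d1 : 0 < (d / (W + 1)) by rewrite divr_gt0// ltr_wpDl.
  have d2 : 0 < (d / (W + 1)) `^ p^-1 by rewrite powR_gt0.
  have [m [nm hm]] := filter_ex (filterI (nbhs_infty_ge n)
    (near_all_seq s (fun k => cvg_rnorm (cv k) d2))).
  apply: (@le_trans _ _ (\sum_(k <- s) (wpow p w (x m - x n) k + d / (W + 1) * w k `^ p))).
    apply: ler_sum_mem => k ks.
    have -> : (fun k => l k - x n k) = (fun k => (x m - x n) k + (l k - x m k)).
      by apply/funext => j; rewrite L1addE L1oppE [RHS]addrC addrA subrK.
    apply: le_trans (wpowD _ _ _) _; rewrite lerD2l /wpow ler_wpM2r ?powR_ge0//.
    have := hm _ ks; rewrite -/(l k) => /(@ge0_ler_powR _ p).
    rewrite !nnegrE (ltW p0) rnorm_ge0 powR_ge0 -powRrM mulVf ?gt_eqF//.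
    by rewrite powRr1 ?(ltW d1)//; exact.
  rewrite big_split /= -mulr_sumr -/W lerD//; first exact: (xe _ _ nm).
  rewrite mulrAC ler_pdivrMr ?ltr_wpDl// ler_wpM2l ?ltW//; lra.
have sl : abs_summable l.
  have h0 : abs_summable (fun k => l k - x 0%N k).
    by exists (e 0%N `^ p^-1); exact: wpow_rnorm p01 w1 (hl 0%N).
  have := abs_summableD h0 (l1P (x 0%N)).
  by congr abs_summable; apply/funext => k; rewrite subrK.
by exists (MkL1 sl) => n; exact: hl.
Qed.

(** The factor [unit_pnorm + 1] accounts for n = 0, where the power is the unit; being at least 1,
    it is harmless for the other powers. *)
Lemma lp_leX r q n : lp_le r q -> lp_le (r ^+ n) ((unit_pnorm + 1) * q ^+ n).
Proof.
move=> hr; have q0 := lp_le_ge0 hr; have b0 := lp_le_ge0 lp_le1.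
case: n => [|n].
  by rewrite !expr0 mulr1; apply: lp_le_trans lp_le1; rewrite lerDl.
apply: (@lp_le_trans _ (q ^+ n.+1)); first by rewrite ler_peMl ?exprn_ge0// lerDr.
elim: n => [|n IH]; first by rewrite !expr1.
by rewrite exprS [q ^+ _]exprS; apply: lp_leM.
Qed.

(** The explicit bound on [h] is what later keeps a constant uniform over a neighbourhood of a point
    of the circle. *)
Lemma neumann_series r q : lp_le r q -> q < 1 ->
  exists h, [/\ h * (1 - r) = 1, (1 - r) * h = 1 &
    lp_le h ((unit_pnorm + 1) / (1 - q))].
Proof.
move=> hr q1; have q0 := lp_le_ge0 hr; have b0 := lp_le_ge0 lp_le1.
set C := unit_pnorm + 1; have C0 : 0 <= C by rewrite /C addr_ge0.
have q1' : 0 < 1 - q by rewrite subr_gt0.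
have qn0 : (fun n => q ^+ n) @ \oo --> (0 : R).
  by apply: cvg_expr; rewrite ger0_norm.
pose e n := C / (1 - q) * q ^+ n.
have e0 : e @ \oo --> (0 : R).
  rewrite -(mulr0 (C / (1 - q))); apply: cvgM; [exact: cvg_cst|exact: qn0].
pose S n : L1 A := \sum_(i < n) r ^+ i.
have hS m n : (n <= m)%N -> lp_le (S m - S n) (e n).
  move=> nm; have -> : S m - S n = \sum_(n <= i < m) r ^+ i.
    rewrite /S -!(big_mkord xpredT (fun i => r ^+ i)) (big_cat_nat (n := n))//=.
    by rewrite [LHS]addrAC subrr add0r.
  apply: lp_le_trans (lp_le_sum _ (fun i => lp_leX i hr)).
  rewrite -mulr_sumr /e -mulrA ler_wpM2l//.
  rewrite mulrC ler_pdivlMr//.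
  have -> : (\sum_(n <= i < m) q ^+ i) * (1 - q) = q ^+ n - q ^+ m.
    rewrite -(subnKC nm); elim: (m - n)%N => [|k IH].
      by rewrite addn0 big_geq// mul0r subrr.
    rewrite addnS big_nat_recr ?leq_addr//= mulrDl IH exprS; ring.
  by rewrite gerBl exprn_ge0.
have [h hh] := lp_complete hS e0.
have hb : lp_le h (C / (1 - q)).
  have := hh 0%N; rewrite /S big_ord0 subr0 /e expr0 mulr1.
  by apply: lp_le_trans.
have D : lp_le (1 - r) (unit_pnorm + q) by exact: lp_leB lp_le1 hr.
have lim0 K : (fun n => K * q ^+ n) @ \oo --> (0 : R).
  rewrite -[X in _ --> X](mulr0 K); apply: cvgM; [exact: cvg_cst|exact: qn0].
have rS n : (1 - r) * S n = 1 - r ^+ n.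
  by rewrite -[1 - r ^+ n]opprB subrX1 -mulNr opprB.
have Sr n : S n * (1 - r) = 1 - r ^+ n.
  rewrite -rS; apply/commr_sym; rewrite /S; apply: commr_sum => i _.
  by apply/commrX/commr_sym/commrB; [exact: commr1|exact: commr_refl].
(* Either product differs from 1 by an element that obeys this bound for every [n]. *)
have kill z : (forall n, lp_le z (((unit_pnorm + q) * (C / (1 - q)) + C) * q ^+ n)) -> z = 0.
  move=> hz; apply: lp_eq0 => d d0.
  have [N hN] := cvg0_small (lim0 ((unit_pnorm + q) * (C / (1 - q)) + C)) d0.
  apply: lp_le_trans (hz N); exact: hN.
exists h; split=> //.
- apply/eqP; rewrite -subr_eq0; apply/eqP/kill => n.
  have -> : h * (1 - r) - 1 = (h - S n) * (1 - r) - r ^+ n.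
    by rewrite mulrBl Sr -[RHS]addrA -opprD subrK.
  rewrite [(_ + C) * _]mulrDl; apply: lp_leB; last exact: lp_leX.
  by rewrite -mulrA mulrC; apply: lp_leM => //; exact: hh.
- apply/eqP; rewrite -subr_eq0; apply/eqP/kill => n.
  have -> : (1 - r) * h - 1 = (1 - r) * (h - S n) - r ^+ n.
    by rewrite mulrBr rS -[RHS]addrA -opprD subrK.
  rewrite [(_ + C) * _]mulrDl; apply: lp_leB; last exact: lp_leX.
  by rewrite -mulrA; apply: lp_leM => //; exact: hh.
Qed.

End Pnorm.

(** * The averaging kernel *)

Section Cis.
Context {R : realType}.
Implicit Types (x y : R).

Definition cis x : R[i] := cos x +i* sin x.

Lemma cis0 : cis 0 = 1.
Proof. by rewrite /cis cos0 sin0. Qed.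

Lemma cisD x y : cis (x + y) = cis x * cis y.
Proof. by rewrite /cis cosD sinD; apply/eqP;
  rewrite eq_complex /= addrC eqxx [X in X == _]addrC eqxx. Qed.

Lemma cis_norm x : `|cis x| = 1.
Proof. by rewrite normc_def /= cos2Dsin2 sqrtr1. Qed.

Lemma cisX x n : cis x ^+ n = cis (n%:R * x).
Proof.
elim: n => [|n IH]; first by rewrite mul0r cis0.
by rewrite exprS IH -cisD mulrSr mulrDl mul1r addrC.
Qed.

(** If cos x = 1, the half-angle formula makes sin (x / 2) vanish, which is impossible for x / 2
    strictly between 0 and pi. *)
Lemma cis_neq1 x : 0 < x -> x < pi *+ 2 -> cis x != 1.
Proof.
move=> x0 xpi; apply/eqP => -[cx _].
have : 0 < sin (x / 2) by apply: sin_gt0_pi; rewrite ?divr_gt0// ltr_pdivrMr//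
  mulr_natr.
have := cos2Dsin2 (x / 2); have : cos (x / 2 + x / 2) = 1 by rewrite -splitr.
rewrite cosD => h1 h2 h3.
have : sin (x / 2) ^+ 2 = 0 by nra.
by move=> /eqP; rewrite expf_eq0 /= gt_eqF.
Qed.

Lemma cis_prim_root L : (0 < L)%N -> L.-primitive_root (cis (pi *+ 2 / L%:R)).
Proof.
move=> L0; apply/andP; split=> //; apply/forallP => -[i iL] /=.
rewrite unity_rootE cisX; have L0' : 0 < L%:R :> R by rewrite ltr0n.
have [->|ne] := eqVneq i.+1 L.
  have Ln0 : L%:R != 0 :> R by rewrite gt_eqF.
  rewrite mulrCA divff// mulr1 /cis cos2pi sin2pi; by rewrite eq_complex /= !eqxx.
have tp : 0 < pi *+ 2 :> R by rewrite mulrn_wgt0// pi_gt0.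
apply/eqP/negbTE/cis_neq1; first by rewrite mulr_gt0// divr_gt0.
rewrite mulrA ltr_pdivrMr// mulrC ltr_pM2l//.
by rewrite ltr_nat ltn_neqAle ne.
Qed.

Lemma cis_surj (z : R[i]) : `|z| = 1 -> exists2 x, x \in `[-pi, pi] & z = cis x.
Proof.
case: z => a b; rewrite normc_def /= => /eqP;
  rewrite eq_complex /= eqxx andbT => /eqP h.
have ab : a ^+ 2 + b ^+ 2 = 1.
  have : Num.sqrt (a ^+ 2 + b ^+ 2) ^+ 2 = 1 by rewrite h expr1n.
  by rewrite sqr_sqrtr// addr_ge0 ?sqr_ge0.
have a1 : -1 <= a <= 1.
  by apply/andP; split; have := sqr_ge0 b; nra.
have ac0 := acos_ge0 a1; have acpi := acos_lepi a1.
have pi0 := pi_ge0 R.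
have sb : sin (acos a) = `|b|.
  rewrite sin_acos// -sqrtr_sqr; congr Num.sqrt; lra.
have [b0|b0] := leP 0 b.
  exists (acos a); first by rewrite in_itv /=; apply/andP; split; lra.
  by rewrite /cis acosK// sb ger0_norm.
exists (- acos a); first by rewrite in_itv /=; apply/andP; split; lra.
by rewrite /cis cosN sinN acosK// sb ltr0_norm// opprK.
Qed.

Lemma cis_conj x : (cis x)^-1 = cis (- x).
Proof.
apply: (@mulfI _ (cis x)); first by rewrite -normr_eq0 cis_norm oner_eq0.
rewrite -cisD subrr cis0 divff// -normr_eq0 cis_norm oner_eq0//.
Qed.

End Cis.

(* [c] is a coefficient, at X^s, of ((1 - X^M) / (1 - X))^k that is at least the
   mean one; averaging over the k * M roots of unity isolates it. *)
Lemma kernel_average (R : realType) (B : algType R[i]) (U : B) (k M : nat) :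
  (0 < k)%N -> (0 < M)%N ->
  let L := (k * M)%N in let e := cis (pi *+ 2 / L%:R : R) in
  exists (s : nat) (c : R), M%:R ^+ k <= c * L%:R /\
  (c * L%:R)%:C *: U ^+ s =
    \sum_(t < L) (e ^+ t) ^+ s *: (\sum_(i < M) ((e ^+ t)^-1 *: U) ^+ i) ^+ k.
Proof.
move=> k0 M0 L e; have L0 : (0 < L)%N by rewrite muln_gt0 k0.
have pe : L.-primitive_root e by exact: cis_prim_root.
pose q : {poly R} := (\sum_(i < M) 'X^i) ^+ k.
(* The degree k (M - 1) is less than L, so distinct exponents of [q] stay distinct modulo L. *)
have sq : (size q <= L)%N.
  have sG : (size (\sum_(i < M) 'X^i : {poly R})%R <= M)%N.
    apply: (leq_trans (size_sum _ _ _)); apply/bigmax_leqP => i _.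
    by rewrite size_polyXn.
  rewrite /q; apply: (leq_trans (size_poly_exp_leq _ _)).
  rewrite /L; nia.
have q1 : \sum_(j < L) q`_j = M%:R ^+ k.
  have : q.[1] = M%:R ^+ k.
    rewrite /q horner_exp horner_sum; congr (_ ^+ _).
    under eq_bigr do rewrite hornerXn expr1n.
    by rewrite sumr_const card_ord.
  rewrite (horner_coef_wide _ sq) => <-.
  by apply: eq_bigr => j _; rewrite expr1n mulr1.
(* The L coefficients add up to q(1) = M^k, so one of them reaches the mean. *)
have [s sc] : exists s : 'I_L, M%:R ^+ k <= q`_s * L%:R.
  apply: contrapT => /forallNP h.
  have : \sum_(j < L) q`_j * L%:R < \sum_(j < L) M%:R ^+ k.
    apply: ltr_sum; first by apply/hasP; exists (Ordinal L0); rewrite ?mem_index_enum.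
    by move=> j _; rewrite ltNge; apply/negP/h.
  by rewrite -mulr_suml q1 sumr_const card_ord -[ltRHS]mulr_natr ltxx.
exists s, q`_s; split=> //.
have hV (V : B) : (\sum_(i < M) V ^+ i) ^+ k = \sum_(j < L) (q`_j)%:C *: V ^+ j.
  pose Q := map_poly (real_complex R) q.
  have -> : (\sum_(i < M) V ^+ i) ^+ k = horner_alg V Q.
    rewrite /Q /q !rmorphXn !rmorph_sum /=; congr (_ ^+ _); apply: eq_bigr => i _.
    by rewrite map_polyXn rmorphXn /= horner_algX.
  have {1}-> : Q = \sum_(j < L) (q`_j)%:C *: 'X^j.
    rewrite -(poly_def L (fun j => (q`_j)%:C)); apply/polyP => j;
      rewrite coef_poly coef_map /=.
    by case: ltnP => // jL; rewrite nth_default ?rmorph0// (leq_trans sq).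
  rewrite linear_sum /=; apply: eq_bigr => j _.
  by rewrite linearZ /= rmorphXn /= horner_algX mulr_algl.
under eq_bigr do rewrite hV scaler_sumr.
rewrite exchange_big /=.
rewrite (bigD1 s)//= [X in _ + X]big1 ?addr0; last first.
  move=> j js.
  have en0 : e != 0 by rewrite -normr_eq0 cis_norm oner_eq0.
  (* For j other than s, the sum over t is geometric with ratio [u], an L-th root of unity different
     from 1, and vanishes. *)
  pose u := e ^+ s / e ^+ j.
  have uL : u ^+ L = 1.
    have eL n : (e ^+ n) ^+ L = 1 by rewrite -exprM mulnC exprM (prim_expr_order pe) expr1n.
    by rewrite /u exprMn exprVn !eL invr1 mulr1.
  have u1 : u - 1 != 0.
    rewrite subr_eq0; apply/eqP => /(congr1 ( *%R^~ (e ^+ j))).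
    rewrite /u divfK ?expf_neq0// mul1r => /eqP.
    rewrite (eq_prim_root_expr pe) !modn_small//.
    by move=> sj; move: js; rewrite -val_eqE /= eq_sym sj.
  have S0 : \sum_(t < L) u ^+ t = 0.
    by apply/(mulfI u1); rewrite -subrX1 uL subrr mulr0.
  transitivity ((\sum_(t < L) u ^+ t) *: ((q`_j)%:C *: U ^+ j));
    last by rewrite S0 scale0r.
  rewrite scaler_suml; apply: eq_bigr => t _.
  rewrite exprZn !scalerA; congr (_ *: _).
  rewrite /u exprMn !exprVn -!exprM ![(t * _)%N]mulnC; ring.
rewrite (eq_bigr (fun=> (q`_s)%:C *: U ^+ s)).
  by rewrite sumr_const card_ord -[RHS]scaler_nat scalerA mulrC rmorphM rmorph_nat.
move=> t _; rewrite exprZn !scalerA; congr (_ *: _).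
rewrite exprVn mulrAC divff ?mul1r// !expf_neq0//.
by rewrite -normr_eq0 cis_norm oner_eq0.
Qed.

Section InLp.
Context {R : realType} {A : banachAlgType R[i]}.
Variables (p : R) (w : int -> R).
Hypotheses (p01 : 0 < p <= 1) (ww : weight w).
Implicit Types (x y r : L1 A).

Definition in_lp x := exists c, lp_le p w x c.

Lemma in_lpD x y : in_lp x -> in_lp y -> in_lp (x + y).
Proof. by move=> [c hc] [d hd]; exists (c + d); exact: lp_leD. Qed.

Lemma in_lpN x : in_lp x -> in_lp (- x).
Proof. by move=> [c hc]; exists c; exact: lp_leN. Qed.

Lemma in_lpB x y : in_lp x -> in_lp y -> in_lp (x - y).
Proof. by move=> hx hy; apply: in_lpD => //; exact: in_lpN. Qed.

Lemma in_lpM x y : in_lp x -> in_lp y -> in_lp (x * y).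
Proof. by move=> [c hc] [d hd]; exists (c * d); exact: lp_leM. Qed.

Lemma in_lpZ z x : in_lp x -> in_lp (z *: x).
Proof. by move=> [c hc]; exists (cabs z `^ p * c); exact: lp_leZ. Qed.

Lemma in_lp_atom i a : in_lp (L1atom i a).
Proof. by eexists; exact: lp_le_atom. Qed.

Lemma in_lp1 : in_lp 1. Proof. exact: in_lp_atom. Qed.

Lemma in_lp0 : in_lp 0. Proof. by exists 0; exact: lp_le0. Qed.

Lemma in_lpX x n : in_lp x -> in_lp (x ^+ n).
Proof.
move=> fx; elim: n => [|n IH]; first exact: in_lp1.
by rewrite exprS; apply: in_lpM.
Qed.

Lemma in_lp_sum (I : Type) (s : seq I) (F : I -> L1 A) :
  (forall i, in_lp (F i)) -> in_lp (\sum_(i <- s) F i).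
Proof.
move=> h; elim: s => [|i s IH]; first by rewrite big_nil; exact: in_lp0.
by rewrite big_cons; exact: in_lpD.
Qed.

End InLp.

Section Atoms.
Context {R : realType} {A : banachAlgType R[i]}.
Implicit Types (x y : L1 A) (a b : A).

Lemma L1atomME i a x n : (L1atom i a * x) n = a * x (n - i).
Proof. by rewrite L1mulE /= convz_atom. Qed.

Lemma L1atomM i j a b : L1atom i a * L1atom j b = L1atom (i + j) (a * b).
Proof.
apply/L1_eq/funext => n; rewrite L1atomME /= /atom subr_eq addrC.
by case: eqP => _; rewrite ?mulr0.
Qed.

Lemma L1atomC i x : L1atom i 1 * x = x * L1atom i 1.
Proof.
apply/L1_eq/funext => n; rewrite L1atomME mul1r L1mulE /convz (@zsum1 _ _ _ i) /=.
  by rewrite /atom eqxx mulr1.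
by move=> m /negPf mi; rewrite /atom mi mulr0.
Qed.

Lemma L1atomX n : L1atom 1 1 ^+ n = L1atom n%:Z 1 :> L1 A.
Proof.
elim: n => [|n IH]; first by [].
by rewrite exprS IH L1atomM mulr1; congr L1atom; lia.
Qed.

End Atoms.

Definition one_weight {R : realType} : int -> R := fun=> 1.

Lemma one_weight_weight (R : realType) : weight (one_weight : int -> R).
Proof. by split=> *; rewrite /one_weight ?lexx ?mulr1. Qed.

Lemma geom_sumX (B : nzRingType) (V : B) M k :
  (\sum_(i < M) V ^+ i) ^+ k * (1 - V) ^+ k = (1 - V ^+ M) ^+ k.
Proof.
have cV : GRing.comm (1 - V) (\sum_(i < M) V ^+ i).
  apply: commr_sum => i _; apply/commrX/commr_sym/commrB; first exact: commr1.
  exact: commr_refl.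
rewrite -exprMn_comm; last exact/commr_sym.
by congr (_ ^+ _); rewrite -cV -[RHS]opprB subrX1 -mulNr opprB.
Qed.

(** * From local identities to an approximate left inverse *)

Section WienerAverage.
Context {R : realType} {A : banachAlgType R[i]}.
Variables (p : R).
Hypotheses (p01 : 0 < p <= 1).
Implicit Types (x y f g : L1 A).
Notation bd := (lp_le p one_weight).
Notation fi := (in_lp p one_weight).
Let w1 := one_weight_weight R.

Lemma cabs_real (r : R) : cabs r%:C = `|r|.
Proof. by rewrite /cabs normc_def /= expr0n addr0 sqrtr_sqr. Qed.

Lemma cabs1 (z : R[i]) : `|z| = 1 -> cabs z = 1.
Proof. by rewrite /cabs => ->. Qed.

Definition unit_shift (z : R[i]) : L1 A := z^-1 *: L1atom 1 1.

Lemma unit_shiftC z x : unit_shift z * x = x * unit_shift z.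
Proof. by rewrite /unit_shift -scalerAl L1atomC scalerAr. Qed.

Lemma lp_le_shift i x c : bd x c -> bd (L1atom i 1 * x) c.
Proof.
move=> hx; apply: sums_le_mono (sums_le_inj (h := fun n => n - i) _ hx);
  last exact: addIr.
by move=> n; rewrite /wpow L1atomME mul1r; exact: lexx.
Qed.

Lemma lp_le_unit z x c : `|z| = 1 -> bd x c -> bd (z *: x) c.
Proof. by move=> z1 /(lp_leZ z); rewrite cabs1// powR1 mul1r. Qed.

Lemma lp_le_unit_shiftX z n x c : `|z| = 1 -> bd x c -> bd (unit_shift z ^+ n * x) c.
Proof.
move=> z1 hx; rewrite exprZn L1atomX -scalerAl; apply: lp_le_unit.
  by rewrite normrX normrV ?z1 ?invr1 ?expr1n// unitfE -normr_eq0 z1 oner_eq0.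
exact: lp_le_shift.
Qed.

Lemma lp_le_1subX z n k x c : `|z| = 1 -> bd x c ->
  bd ((1 - unit_shift z ^+ n) ^+ k * x) (2 ^+ k * c).
Proof.
move=> z1; elim: k x c => [|k IH] x c hx; first by rewrite !expr0 !mul1r.
rewrite exprSr -mulrA exprSr -mulrA; apply: IH.
rewrite mulrBl mul1r mulrDl mul1r; apply: lp_leB => //; exact: lp_le_unit_shiftX.
Qed.

(* Raising [1 - V] to the power [k] makes the remainder small in l^p, as soon as
   [k * p > 1], once it is multiplied by the kernel of [kernel_average]. *)
Lemma ideal_iter f b y V k : (forall x, V * x = x * V) -> fi b -> fi y -> fi V ->
  1 = b * f + (1 - V) * y ->
  exists2 B, fi B & 1 = B * f + (1 - V) ^+ k * y ^+ k.
Proof.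
move=> Vc fb fy fV e1; elim: k => [|k [B fB e]].
  by exists 0; [exact: in_lp0|rewrite !expr0 mul0r mulr1 add0r].
have f1V : fi (1 - V) by apply: in_lpB => //; exact: in_lp1.
exists (B + (1 - V) ^+ k * y ^+ k * b).
  apply: (in_lpD p01 fB); apply: (in_lpM p01 w1 _ fb).
  by apply: (in_lpM p01 w1); apply: (in_lpX p01 w1).
rewrite {1}e mulrDl -addrA; congr (_ + _).
(* The factor inserted on the right is 1. As V is central, its 1 - V moves past [y ^+ k] to join the
   power. *)
transitivity ((1 - V) ^+ k * y ^+ k * (b * f + (1 - V) * y)).
  by rewrite -e1 mulr1.
rewrite mulrDr; congr (_ + _); first by rewrite mulrA.
have cV : GRing.comm (y ^+ k) (1 - V).
  by apply: commrB; [exact: commr1|rewrite /GRing.comm Vc].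
by rewrite mulrA exprSr exprSr -!mulrA; congr (_ * _); rewrite !mulrA cV.
Qed.

Lemma wiener_average f (K : R) :
  (forall t, exists b y, [/\ fi b, bd y K & 1 = b * f + (1 - unit_shift (cis t)) * y]) ->
  forall eta, 0 < eta -> exists2 g, fi g & bd (1 - g * f) eta.
Proof.
move=> H eta eta0; have /andP[p0 p1] := p01.
have K0 : 0 <= K by have [b [y [_ hy _]]] := H 0; exact: lp_le_ge0 hy.
(* With k p >= 2 the normalization contributes at most M^(-2) against the k M terms of the average,
   which leaves k / M. *)
pose k := (Num.truncn (2 / p)).+1.
have kp : 2 <= k%:R * p.
  by rewrite -ler_pdivrMr// ltW// truncnS_gt.
(* [C / M] will bound the remainder: 2^k comes from (1 - V^M)^k, the last factor from [y ^+ k], and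
   k from the k M terms. *)
pose C : R := k%:R * (2 ^+ k * ((unit_pnorm p one_weight (A := A) + 1) * K ^+ k)).
pose M := (Num.truncn (C / eta)).+1.
have MC : C <= eta * M%:R by rewrite mulrC -ler_pdivrMr// ltW// truncnS_gt.
have M0 : 0 < M%:R :> R by rewrite ltr0n.
pose L := (k * M)%N; pose e := cis (pi *+ 2 / L%:R : R).
have [s [c [cL ker]]] := kernel_average (L1atom 1 1 : L1 A) (ltn0Sn _ : 0 < k)%N (ltn0Sn _ : 0 < M)%N.
rewrite -/L -/e in cL ker.
have cL0 : 0 < c * L%:R by apply: lt_le_trans cL; rewrite exprn_gt0.
have et t : e ^+ t = cis (t%:R * (pi *+ 2 / L%:R)) by rewrite cisX.
pose G (t : nat) : L1 A := (\sum_(i < M) unit_shift (e ^+ t) ^+ i) ^+ k.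
have hT (t : nat) : exists BE : L1 A * L1 A, [/\ fi BE.1,
    bd BE.2 (2 ^+ k * ((unit_pnorm p one_weight (A := A) + 1) * K ^+ k)) &
    G t = BE.1 * f + BE.2].
  have [b [y [fb hy e1]]] := H (t%:R * (pi *+ 2 / L%:R)).
  rewrite -et in e1; set V := unit_shift _ in e1.
  have Vc x : V * x = x * V by exact: unit_shiftC.
  have fV : fi V by apply: in_lpZ => //; exact: in_lp_atom.
  have [B fB eB] := ideal_iter k Vc fb (ex_intro _ _ hy) fV e1.
  exists (G t * B, (1 - V ^+ M) ^+ k * y ^+ k); split => /=.
  - by apply: in_lpM => //; apply: in_lpX => //; apply: in_lp_sum => // i;
    exact: in_lpX.
  - by apply: lp_le_1subX; [rewrite et cis_norm|apply: lp_leX].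
  transitivity (G t * (B * f + (1 - V) ^+ k * y ^+ k)).
    by rewrite -eB mulr1.
  by rewrite mulrDr mulrA [X in _ + X]mulrA /G /= geom_sumX.
have [BE hBE] := choice hT.
pose u : R[i] := (c * L%:R)%:C^-1.
have cLn0 : (c * L%:R)%:C != 0 :> R[i] by rewrite eq_complex /= eqxx andbT gt_eqF.
have un : cabs u = (c * L%:R)^-1.
  apply: (@mulfI _ (c * L%:R)); first by rewrite gt_eqF.
  rewrite divff ?gt_eqF// -{1}[c * L%:R]gtr0_norm// -cabs_real -cabsM /u divff//.
  by rewrite cabs1 ?normr1.
(* The average of [kernel_average], translated by -s and divided by c L, so that [T G = 1]. Applied
   to the local identities, [T] yields both [g] and the remainder. *)
pose T (E : nat -> L1 A) :=
  L1atom (- s%:Z) 1 * (u *: \sum_(t < L) (e ^+ t) ^+ s *: E t).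
have TG : T G = 1.
  rewrite /T -ker scalerA /u mulVf// scale1r L1atomX L1atomM mulr1.
  by rewrite addNr.
exists (T (fun t => (BE t).1)).
  apply: in_lpM => //; first exact: in_lp_atom.
  apply: in_lpZ => //; apply: in_lp_sum => // t; apply: in_lpZ => //.
  by have [] := hBE t.
have -> : 1 - T (fun t => (BE t).1) * f = T (fun t => (BE t).2).
  rewrite -TG /T -mulrA -mulrBr -scalerAl -scalerBr mulr_suml -sumrB.
  congr (_ * (_ *: _)); apply: eq_bigr => t _; rewrite -scalerAl -scalerBr.
  by have [_ _ ->] := hBE t; rewrite addrAC subrr add0r.
apply: lp_le_shift; apply: (@lp_le_trans _ _ _ _ _ (cabs u `^ p *
  \sum_(t < L) (2 ^+ k * ((unit_pnorm p one_weight (A := A) + 1) * K ^+ k))));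
    last first.
  apply: lp_leZ => //; apply: lp_le_sum => // t; apply: lp_le_unit.
    by rewrite et normrX cis_norm expr1n.
  by have [] := hBE t.
rewrite un sumr_const card_ord -[X in _ * X]mulr_natr.
set Q := 2 ^+ k * _; have Q0 : 0 <= Q.
  rewrite mulr_ge0 ?exprn_ge0// mulr_ge0 ?exprn_ge0//.
  have b1 : bd (1 : L1 A) (unit_pnorm p one_weight (A := A)) by exact: lp_le1.
  by rewrite addr_ge0//; exact: lp_le_ge0 b1.
have xM : (c * L%:R)^-1 `^ p <= (M%:R ^+ 2)^-1.
  apply: (@le_trans _ _ (((M%:R ^+ k)^-1) `^ p)).
    rewrite ge0_ler_powR ?nnegrE ?invr_ge0 ?(ltW p0) ?exprn_ge0 ?(ltW cL0) ?(ltW M0)//.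
    by rewrite lef_pV2 ?posrE// exprn_gt0.
  rewrite -powR_mulrn ?(ltW M0)// -powRN -powRrM -powR_mulrn ?(ltW M0)// -powRN.
  by rewrite ler_powR ?ler1n// mulNr lerN2.
apply: le_trans (ler_wpM2r _ xM) _; first by rewrite mulr_ge0.
rewrite -ler_pdivlMl ?invr_gt0 ?exprn_gt0// invrK.
have := ler_wpM2r (ltW M0) MC; rewrite /C -/Q /L natrM.
by congr (_ <= _); ring.
Qed.

End WienerAverage.

(** * Wiener's lemma without weights *)

Section Fourier.
Context {R : realType} {A : banachAlgType R[i]}.
Implicit Types (f g : int -> A) (z : R[i]) (a b : A).

Lemma cabs_exprz z (n : int) : `|z| = 1 -> cabs (z ^ n) = 1.
Proof. move=> z1; apply: cabs1; case: n => n; first by rewrite normrX z1 expr1n.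
by rewrite NegzE -exprnN normfV normrX z1 expr1n invr1. Qed.

Lemma fourier_sums_le f z (p c : R) : `|z| = 1 ->
  sums_le (fun n => rnorm (f n) `^ p) c ->
    sums_le (fun n => rnorm (z ^ n *: f n) `^ p) c.
Proof.
move=> z1 h; apply: sums_le_mono h => n.
by rewrite rnormZ cabs_exprz// mul1r.
Qed.

Lemma fourier_summable f z : `|z| = 1 -> abs_summable f ->
  abs_summable (fun n => z ^ n *: f n).
Proof.
move=> z1 [c h]; exists c; apply: sums_le_mono h => n.
by rewrite rnormZ cabs_exprz// mul1r.
Qed.

Lemma fourierD f g z : `|z| = 1 -> abs_summable f -> abs_summable g ->
  fourier (fun n => f n + g n) z = fourier f z + fourier g z.
Proof.
move=> z1 sf sg; rewrite /fourier -zsumD; [|exact: fourier_summable..].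
by congr zsum; apply/funext => n; rewrite scalerDr.
Qed.

Lemma fourier_atom i a z : fourier (atom i a) z = z ^ i *: a.
Proof.
rewrite /fourier (@zsum1 _ _ _ i); first by rewrite /atom eqxx.
by move=> m /negPf mi; rewrite /atom mi scaler0.
Qed.

Lemma fourier_le f z c : `|z| = 1 -> sums_le (fun n => rnorm (f n)) c ->
  rnorm (fourier f z) <= c.
Proof.
move=> z1 h; apply: zsum_le; apply: sums_le_mono h => n.
by rewrite rnormZ cabs_exprz// mul1r.
Qed.

Lemma fourier_powle f z p c : 0 < p <= 1 -> `|z| = 1 -> abs_summable f ->
  sums_le (wpow p one_weight f) c -> rnorm (fourier f z) `^ p <= c.
Proof.
move=> p01 z1 sf h; apply/ler_addgt0Pr => e e0.
have [n hn] := filter_ex (zsum_pow p01 (fourier_summable z1 sf) e0).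
apply: le_trans hn _; rewrite lerD2r; apply: fourier_sums_le (window_uniq n) => //.
by apply: sums_le_mono h => k; rewrite /wpow powR1 mulr1.
Qed.

End Fourier.

Section Wiener.
Context {R : realType} {A : banachAlgType R[i]}.
Variables (p : R).
Hypotheses (p01 : 0 < p <= 1).
Implicit Types (x y f g : L1 A) (z : R[i]).
Notation bd := (lp_le p one_weight).
Notation fi := (in_lp p one_weight).
Let w1 := one_weight_weight R.

(** The analogue of the divisibility of X^i - z^i by X - z. For i >= 0 the geometric sum multiplies
    the value at z, for i < 0 the monomial itself. *)
Lemma L1atom_division i a z : `|z| = 1 ->
  exists2 y, fi y & L1atom i a - L1atom 0 (z ^ i *: a) = (1 - unit_shift (A :=
    A) z) * y.
Proof.
move=> z1; have z0 : z != 0 by rewrite -normr_eq0 z1 oner_eq0.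
have fV : fi (unit_shift (A := A) z) by apply: in_lpZ; exact: in_lp_atom.
have fG n : fi (\sum_(j < n) unit_shift (A := A) z ^+ j) by apply: in_lp_sum => //
  j; exact: in_lpX.
have VG n : (1 - unit_shift (A := A) z) * \sum_(j < n) unit_shift (A :=
  A) z ^+ j = 1 - unit_shift (A := A) z ^+ n.
  by rewrite -[RHS]opprB subrX1 -mulNr opprB.
have atZ j (c : R[i]) b : L1atom j (c *: b) = c *: L1atom j b.
  by apply/L1_eq/funext => k; rewrite /= /atom; case: eqP; rewrite ?scaler0.
have VX n b j : unit_shift (A :=
  A) z ^+ n * L1atom j b = z ^- n *: L1atom (n%:Z + j) b.
  by rewrite /unit_shift exprZn L1atomX -scalerAl L1atomM mul1r exprVn.
case: i => n.
  exists ((\sum_(j < n) unit_shift (A := A) z ^+ j) * (- L1atom 0 (z ^+ n *: a))).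
    by apply: in_lpM => //; apply: in_lpN; exact: in_lp_atom.
  rewrite mulrA VG mulrN mulrBl mul1r opprB VX addr0 atZ scalerA.
  by rewrite mulVf ?expf_neq0// scale1r.
exists ((\sum_(j < n.+1) unit_shift (A := A) z ^+ j) * L1atom (Negz n) a).
  by apply: in_lpM => //; exact: in_lp_atom.
rewrite mulrA VG mulrBl mul1r VX NegzE subrr atZ; congr (_ - _ *: _).
Qed.

Lemma trunc_division (f : L1 A) s z : `|z| = 1 -> uniq s ->
  exists2 y, fi y & MkL1 (trunc_summable s f) - L1atom 0 (fourier (trunc s f) z) =
    (1 - unit_shift (A := A) z) * y.
Proof.
move=> z1; elim: s => [_|i s IH /= /andP[is_ us]].
  exists 0; first exact: in_lp0.
  rewrite mulr0; apply/eqP; rewrite subr_eq0; apply/eqP/L1_eq/funext => k.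
  rewrite /= /atom /fourier; case: eqP => // _;
    rewrite [RHS](@zsum1 _ _ _ 0) ?scaler0//.
  by move=> ? _; rewrite scaler0.
have [y fy ey] := IH us; have [y' fy' ey'] := L1atom_division i (f i) z1.
exists (y' + y); first exact: in_lpD.
rewrite mulrDr -ey -ey' addrACA -opprD; congr (_ - _).
  by apply/L1_eq; rewrite /= trunc_cons.
apply/L1_eq/funext => k; rewrite /= trunc_cons// fourierD//.
- by rewrite fourier_atom /atom; case: eqP => // _; rewrite addr0.
- exact: atom_summable.
- exact: trunc_summable.
Qed.

(** Only finite sums are divided exactly; the tail of [f] and the value of that tail at z each
    contribute eta / 2 to [e]. *)
Lemma local_division f z (eta : R) : `|z| = 1 -> fi f -> 0 < eta ->
  exists y e, [/\ fi y, bd e eta &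
    f - L1atom 0 (fourier f z) = (1 - unit_shift (A := A) z) * y + e].
Proof.
move=> z1 [c hf] eta0; have e2 : 0 < eta / 2 by rewrite divr_gt0.
have /andP[p0 _] := p01.
have [s us hs] := sums_le_tail (wpow_ge0 p one_weight f) hf e2.
pose f0 := MkL1 (trunc_summable s f); pose f1 := f - f0.
have h1 : bd f1 (eta / 2).
  apply: sums_le_mono hs => k; rewrite /wpow /f1 L1addE L1oppE /= trunc_tail.
  by case: ifP => // _; rewrite rnorm0 powR0 ?gt_eqF// mul0r.
have [y fy ey] := trunc_division f z1 us.
exists y, (f1 - L1atom 0 (fourier f1 z)); split=> //.
  rewrite [eta]splitr; apply: lp_leB => //.
  have := lp_le_atom one_weight p01 0 (fourier f1 z); rewrite /one_weight powR1 mulr1.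
  by apply: lp_le_trans; apply: fourier_powle => //; exact: l1P.
rewrite -ey addrACA -opprD; congr (_ - _); first by rewrite /f1 addrC subrK.
apply/L1_eq/funext => k; rewrite /= /atom; case: eqP => _; last by rewrite addr0.
rewrite -(fourierD z1 (trunc_summable s f) (l1P f1)).
congr (fourier _ _); apply/funext => j.
by rewrite /f1 L1addE L1oppE addrC subrK.
Qed.

(** The bound is on [y], which governs the remainder of the average; [b] ends up inside [g], of
    which only membership in l^p is asked. *)
Definition resolvent_le f (t K : R) := exists b y,
  [/\ fi b, bd y K & 1 = b * f + (1 - unit_shift (A := A) (cis t)) * y].

(** The pair [b0], [y0] found at [t0] is kept nearby: moving V costs a small multiple of U [y0],
    which a Neumann series absorbs. The inverse [h] multiplies from the left and commutes with the
    central V, so the shape of the identity is preserved. *)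
Lemma resolvent_le_near f t0 : fi f ->
  (exists a, a * fourier f (cis t0) = 1) ->
  exists K, \forall t \near t0, resolvent_le f t K.
Proof.
move=> ff [a ha]; have /andP[p0 _] := p01.
have q4 : 0 < 4^-1 :> R by [].
pose na := rnorm a `^ p; have na0 : 0 <= na by exact: powR_ge0.
have e1 : 0 < 4^-1 / (na + 1) by rewrite divr_gt0// ltr_wpDl.
have [y [e [[cy hy] he ey]]] := local_division (cis_norm t0) ff e1.
pose b0 := L1atom 0 a; pose y0 := - (b0 * y); pose e0 := - (b0 * e).
have hb0 : bd b0 na.
  by have := lp_le_atom one_weight p01 0 a; rewrite /one_weight powR1 mulr1.
have he0 : bd e0 4^-1.
  apply: lp_leN; apply: lp_le_trans (lp_leM p01 w1 hb0 he).
  rewrite mulrCA ler_piMr// ler_pdivrMr ?ltr_wpDl//; lra.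
have hy0 : bd y0 (na * cy) by apply: lp_leN; exact: lp_leM.
have eq0 : 1 = b0 * f + (1 - unit_shift (A := A) (cis t0)) * y0 + e0.
  transitivity (b0 * L1atom 0 (fourier f (cis t0))); first by rewrite L1atomM ha.
  rewrite /y0 /e0 mulrN -addrA -opprD.
  have -> : (1 - unit_shift (A :=
    A) (cis t0)) * (b0 * y) = b0 * ((1 - unit_shift (A := A) (cis t0)) * y).
    by rewrite !mulrBl !mul1r mulrBr unit_shiftC -!mulrA unit_shiftC.
  by rewrite -mulrDr -ey -mulrBr opprB addrC subrK.
pose Cy := na * cy; have Cy0 : 0 <= Cy by exact: lp_le_ge0 hy0.
(* Chosen so that d^p Cy is at most 1/4; together with the bound on [e0] this gives the Neumann
   ratio 1/2. *)
pose d := (4^-1 / (Cy + 1)) `^ p^-1.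
have d0 : 0 < d by rewrite powR_gt0// divr_gt0// ltr_wpDl.
exists ((unit_pnorm p one_weight (A := A) + 1) / (1 - (4^-1 + 4^-1)) * Cy).
have nearcis : \forall t \near t0, cabs ((cis t)^-1 - (cis t0)^-1) <= d.
  have d2 : 0 < d / 2 by rewrite divr_gt0.
  have hc : \forall t \near t0, `|cos t0 - cos t| <= d / 2.
    by have /cvgrPdist_le := @continuous_cos R t0; apply.
  have hs : \forall t \near t0, `|sin t0 - sin t| <= d / 2.
    by have /cvgrPdist_le := @continuous_sin R t0; apply.
  apply: filterS2 hc hs => t ht1 ht2.
  rewrite !cis_conj; apply: (@le_trans _ _ (`|cos t0 - cos t| + `|sin t0 - sin t|)); last lra.
  rewrite /cis !cosN !sinN /cabs normc_def /=.
  set u := cos t0 - cos t in ht1 *; set v := sin t0 - sin t in ht2 *.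
  have -> : cos t - cos t0 = - u by rewrite /u opprB.
  have -> : - sin t - - sin t0 = v by rewrite /v opprK addrC.
  rewrite sqrrN -[leRHS]ger0_norm ?addr_ge0// -sqrtr_sqr ler_wsqrtr//.
  rewrite -(real_normK (num_real u)) -(real_normK (num_real v)) sqrrD.
  by rewrite lerD2r lerDl mulrn_wge0// mulr_ge0.
apply: filterS nearcis => t ht.
pose k := (cis t)^-1 - (cis t0)^-1.
pose e' := e0 + k *: (L1atom 1 1 * y0).
have he' : bd e' (4^-1 + 4^-1).
  apply: lp_leD => //; apply: lp_le_trans (lp_leZ k (lp_le_shift 1 hy0)).
  apply: (@le_trans _ _ (d `^ p * Cy)).
    rewrite ler_wpM2r//; rewrite ge0_ler_powR ?nnegrE ?(ltW p0) ?cabs_ge0//.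
    exact: ltW.
  rewrite /d -powRrM mulVf ?gt_eqF// powRr1; last by rewrite divr_ge0// addr_ge0.
  rewrite mulrAC ler_pdivrMr ?ltr_wpDl// ler_wpM2l//; lra.
have lt1 : 4^-1 + 4^-1 < 1 :> R by lra.
have [h [h1 _ hh]] := neumann_series p01 w1 he' lt1.
have eq1 : 1 - e' = b0 * f + (1 - unit_shift (A := A) (cis t)) * y0.
  rewrite {1}eq0 /e' opprD addrA addrK -addrA; congr (_ + _).
  rewrite !mulrBl !mul1r -addrA; congr (_ + _); rewrite -opprD; congr (- _).
  by rewrite /unit_shift -!scalerAl -scalerDl /k addrC subrK.
exists (h * b0), (h * y0); split.
- by apply: in_lpM => //; [eexists; exact: hh|exists na].
- exact: lp_leM.
have cV : h * (1 - unit_shift (cis t)) = (1 - unit_shift (cis t)) * h.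
  by rewrite mulrBl mulrBr unit_shiftC mul1r mulr1.
transitivity (h * (1 - e')); first by rewrite h1.
by rewrite eq1 mulrDr ![h * (_ * _)]mulrA cV -[_ * h * y0]mulrA.
Qed.

Lemma wiener f : fi f ->
  (forall z, `|z| = 1 -> exists a, a * fourier f z = 1) ->
  forall eta, 0 < eta -> exists2 g, fi g & bd (1 - g * f) eta.
Proof.
move=> ff hf.
have /compact_near_coveringP := @segment_compact R (- pi) pi.
(* The bound itself tends to infinity: near each point all large [n] are suitable, and compactness
   provides one [n] for the whole segment. *)
move=> /(_ nat \oo (fun n t => resolvent_le f t n%:R)) hcov.
have [n hn] : exists n : nat, `[- pi, pi]%classic `<=` (fun t => resolvent_le f t n%:R).
  apply: (@filter_ex _ \oo); apply: hcov => t0 _.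
  have [K hK] := resolvent_le_near ff (hf _ (cis_norm t0)).
  exists ([set t | resolvent_le f t K], [set n | K <= n%:R]) => /=; last first.
    move=> [t n] /= [[b [y [fb hy e]]] Kn]; exists b, y; split=> //.
    exact: lp_le_trans hy.
  split=> //; exists (Num.truncn K).+1 => // m /= hm.
  by apply: le_trans (ltW (truncnS_gt K)) _; rewrite ler_nat.
apply: (wiener_average p01 (K := n%:R)) => t.
have [t' t'pi ->] := cis_surj (cis_norm t).
exact: hn.
Qed.

End Wiener.

(** * Weights *)

Section Renorming.
Context {R : realType}.
Implicit Types (w nu : int -> R) (beta : R).

(* The infimal convolution of [beta^|x|] with [nu], after the value of [nu] at 0
   is lowered to 1, is equivalent to [nu] but at most [beta^|x|]. *)
Lemma weight_renorm nu beta C : weight nu -> 1 < beta ->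
  (forall x, nu x <= C * beta ^+ `|x|%N) ->
  exists nu', [/\ weight nu', forall x, nu' x <= nu x,
    forall x, nu' x <= beta ^+ `|x|%N & exists C', forall x, nu x <= C' * nu' x].
Proof.
move=> [n1 nM] b1 hC.
have b0 : 0 < beta by apply: lt_trans b1.
(* With the value 1 at 0, the choice m = x in the infimum gives exactly beta^|x|. *)
pose n0 x := if x == 0 then 1 else nu x.
have n01 x : 1 <= n0 x by rewrite /n0; case: eqP.
have n0n x : n0 x <= nu x by rewrite /n0; case: eqP => // ->.
have n0M x y : n0 (x + y) <= n0 x * n0 y.
  rewrite {1}/n0; case: eqP => [_|xy].
    by rewrite -[leLHS]mulr1; apply: ler_pM.
  rewrite /n0; case: eqP => [x0|_]; first by rewrite x0 add0r mul1r;
    case: eqP => // y0; case: xy; rewrite x0 y0.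
  by case: eqP => [y0|_]; rewrite ?y0 ?addr0 ?mulr1.
have nn0 x : nu x <= nu 0 * n0 x.
  by rewrite /n0; case: eqP => [->|_]; rewrite ?mulr1// ler_peMl// (le_trans ler01).
pose t x m := beta ^+ `|m|%N * n0 (x - m).
have t1 x m : 1 <= t x m.
  by rewrite -[leLHS]mulr1 /t; apply: ler_pM => //; rewrite exprn_ege1// ltW.
pose S x := [set t x m | m in [set: int]].
have S1 x : lbound (S x) 1 by move=> _ [m _ <-].
have St x m : S x (t x m) by exists m.
have S0 x : S x !=set0 by exists (t x 0).
have le_inf x m : inf (S x) <= t x m by apply: ge_inf; [exists 1|].
have inf_ge x c : (forall m, c <= t x m) -> c <= inf (S x).
  by move=> h; apply: lb_le_inf => // _ [m _ <-].
exists (fun x => inf (S x)); split.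
- split=> [x|x y]; first exact: inf_ge.
  (* Decompositions of x at m and of y at n combine into one of x + y at m + n. *)
  have key m n : inf (S (x + y)) <= t x m * t y n.
    apply: le_trans (le_inf _ (m + n)) _; rewrite /t mulrACA -exprD.
    apply: ler_pM; rewrite ?exprn_ge0 ?(ltW b0)//.
    + exact: le_trans (n01 _).
    + by rewrite ler_weXn2l ?(ltW b1)//; lia.
    + by rewrite opprD addrACA.
  have p0 z m : 0 < t z m by apply: lt_le_trans (t1 z m).
  have i0 z : 0 < inf (S z) by apply: lt_le_trans (inf_ge z 1 (t1 z)).
  rewrite -ler_pdivrMl//; apply/inf_ge => n; rewrite ler_pdivrMl// mulrC.
  by rewrite -ler_pdivrMl//; apply/inf_ge => m; rewrite ler_pdivrMl// mulrC.
- move=> x; apply: le_trans (le_inf x 0) _.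
  by rewrite /t expr0 mul1r subr0.
- move=> x; apply: le_trans (le_inf x x) _.
  by rewrite /t subrr /n0 eqxx mulr1.
have C0 : 0 < C.
  by apply: lt_le_trans (le_trans (n1 0) _); [exact: ltr01|have := hC 0;
    rewrite expr0 mulr1].
(* Writing x = m + (x - m), the factor [C] pays for replacing [nu m] by beta^|m|, and [nu 0] for
   replacing [nu] by [n0] at x - m. *)
exists (C * nu 0) => x; rewrite -ler_pdivrMl; last by rewrite mulr_gt0//
  (lt_le_trans ltr01).
apply: inf_ge => m; rewrite ler_pdivrMl; last by rewrite mulr_gt0//
  (lt_le_trans ltr01).
rewrite -{1}(subrKC m x); apply: le_trans (nM _ _) _.
rewrite /t mulrACA; apply: ler_pM => //; exact: le_trans (n1 _).
Qed.

End Renorming.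

(** * Wiener's lemma for weights of slow growth *)

Section WeightedWiener.
Context {R : realType} {A : banachAlgType R[i]}.
Variables (p : R) (w : int -> R).
Hypotheses (p01 : 0 < p <= 1) (ww : weight w).
Implicit Types (f g x : L1 A).

Lemma lp_le_weight_le (w1 w2 : int -> R) x c : (forall k, 1 <= w1 k) ->
  (forall k, w1 k <= w2 k) -> lp_le p w2 x c -> lp_le p w1 x c.
Proof.
move=> h1 h12; have /andP[p0 _] := p01; apply: sums_le_mono => k.
have w10 : 0 <= w1 k by apply: le_trans (h1 k).
rewrite /wpow ler_wpM2l ?powR_ge0// ge0_ler_powR ?nnegrE ?(ltW p0)//.
exact: le_trans (h12 k).
Qed.

Lemma in_lp_weight_le (w1 w2 : int -> R) x C : (forall k, 1 <= w1 k) ->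
  (forall k, 1 <= w2 k) ->
  (forall k, w1 k <= C * w2 k) -> in_lp p w2 x -> in_lp p w1 x.
Proof.
move=> h1 h2 h12 [c hc]; have /andP[p0 _] := p01.
have C0 : 0 <= C.
  have := le_trans (h1 0) (h12 0); have := h2 0.
  case: (lerP 0 C) => // Cn w21 h; have : C * w2 0 <= 0.
    by rewrite nmulr_rle0// (le_trans ler01).
  lra.
exists (C `^ p * c); apply: sums_le_mono (sbdZ (powR_ge0 _ _) hc) => k.
have w20 : 0 <= w2 k by apply: le_trans (h2 k).
rewrite /wpow mulrCA ler_wpM2l ?powR_ge0// -powRM// ge0_ler_powR ?nnegrE ?(ltW p0)//.
  by apply: le_trans (h1 k).
by rewrite mulr_ge0.
Qed.

Lemma in_lp_trunc f s : in_lp p w (MkL1 (trunc_summable s f)).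
Proof.
have /andP[p0 _] := p01; eexists.
apply: sums_le_mono (sums_le_finite s (wpow_ge0 p w f)) => k.
by rewrite /wpow /= /trunc; case: ifP => // _; rewrite rnorm0 powR0 ?gt_eqF// mul0r.
Qed.

End WeightedWiener.

(** [beta] is fixed before [nu], which later lets the root of [w] be chosen to suit it. The
    truncation is needed because [g] is only known to lie in the unweighted space, while a finitely
    supported [G] lies in every weighted one. *)
Theorem weighted_wiener (R : realType) (A : banachAlgType R[i]) (p : R)
    (w : int -> R) (f : L1 A) : 0 < p <= 1 -> weight w -> in_lp p w f ->
  (forall z : R[i], `|z| = 1 -> exists a : A, a * fourier f z = 1) ->
  exists2 beta, 1 < beta & forall nu, weight nu -> (forall x, nu x <= w x) ->
    (exists C, forall x, nu x <= C * beta ^+ `|x|%N) ->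
    exists2 g : L1 A, in_lp p nu g & g * f = 1.
Proof.
move=> p01 ww ff hf; have /andP[p0 p1] := p01.
have w1 := one_weight_weight R.
have le1w k : one_weight k <= w k by case: ww.
have [cf hcf] := ff.
have hcf1 : lp_le p one_weight f cf by apply: lp_le_weight_le hcf.
have q4 : 0 < 4^-1 :> R by [].
have [g [cg hg] gf] := wiener p01 (ex_intro _ _ hcf1) hf q4.
have cf0 : 0 <= cf by exact: lp_le_ge0 hcf1.
have e1 : 0 < 4^-1 / (cf + 1) by rewrite divr_gt0// ltr_wpDl.
have [s us hs] := sums_le_tail (wpow_ge0 p one_weight g) hg e1.
pose G := MkL1 (trunc_summable s g).
pose r := 1 - G * f.
have hgG : lp_le p one_weight (g - G) (4^-1 / (cf + 1)).
  apply: sums_le_mono hs => k; rewrite /wpow L1addE L1oppE trunc_tail.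
  by case: ifP => // _; rewrite rnorm0 powR0 ?gt_eqF// mul0r.
have hr : lp_le p one_weight r 2^-1.
  have -> : r = 1 - g * f + (g - G) * f by rewrite mulrBl addrA subrK.
  apply: lp_le_trans (lp_leD p01 gf (lp_leM p01 w1 hgG hcf1)).
  have : 4^-1 / (cf + 1) * cf <= 4^-1.
    rewrite mulrAC ler_pdivrMr ?ltr_wpDl// ler_wpM2l//; lra.
  lra.
have [cr hcr] : in_lp p w r.
  apply: in_lpB => //; first exact: in_lp1.
  by apply: in_lpM => //; exact: in_lp_trunc.
(* Outside [s1] the remainder contributes at most 1/4 for [w], hence for [nu']. On [s1] the weight
   is at most beta^N = 5/4, and the unweighted bound is 1/2. The total is 5/8 + 1/4 < 1. *)
have [s1 us1 hs1] := sums_le_tail (wpow_ge0 p w r) hcr q4.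
pose N := (\max_(x <- s1) `|x|%N).+1.
pose beta : R := (5 / 4) `^ (N%:R^-1).
have Ni0 : 0 < N%:R^-1 :> R by rewrite invr_gt0 ltr0n.
have b1 : 1 < beta.
  have <- : 1 `^ (N%:R^-1) = 1 :> R by rewrite powR1.
  by rewrite gt0_ltr_powR ?nnegrE//; lra.
have bN : beta ^+ N = 5 / 4.
  by rewrite -powR_mulrn ?powR_ge0// -powRrM mulVf ?pnatr_eq0// powRr1.
exists beta => // nu wn nw [C hC].
have [nu' [wn' n'n n'b [C' hC']]] := weight_renorm wn b1 hC.
have [n'1 _] := wn'.
have rn' : lp_le p nu' r (5 / 4 * 2^-1 + 4^-1).
  have h54 : 0 <= 5 / 4 :> R by lra.
  apply: sums_le_mono (sbdD (sbdZ h54 hr) hs1) => k.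
  have nk0 : 0 <= nu' k by apply: le_trans (n'1 k).
  case: ifPn => [ks|_]; last first.
    rewrite -[leLHS]add0r; apply: lerD; first by rewrite mulr_ge0 ?wpow_ge0.
    rewrite /wpow ler_wpM2l ?powR_ge0// ge0_ler_powR ?nnegrE ?(ltW p0)//.
      by case: ww => w1k _; apply: le_trans (w1k k).
    exact: le_trans (n'n k) (nw k).
  rewrite addr0 /wpow powR1 mulr1 mulrC ler_wpM2r ?powR_ge0//.
  rewrite -bN; apply: (@le_trans _ _ (nu' k `^ 1)); first by rewrite ler_powR.
  rewrite powRr1//; apply: le_trans (n'b k) _.
  rewrite ler_weXn2l ?(ltW b1)// /N leqW//.
  exact: (@leq_bigmax_seq _ s1 xpredT (fun x : int => `|x|%N)).
have lt1 : 5 / 4 * 2^-1 + 4^-1 < 1 :> R by lra.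
have [h [h1 _ hh]] := neumann_series p01 wn' rn' lt1.
(* [h] is found for [nu'], and equivalence of the weights carries it back to [nu]. As 1 - r = G f,
   the identity h (1 - r) = 1 is the claim. *)
exists (h * G).
  apply: in_lpM => //; last exact: in_lp_trunc.
  have [n1 _] := wn.
  by apply: in_lp_weight_le n1 n'1 hC' _ => //; eexists; exact: hh.
by rewrite -mulrA -h1 /r subKr.
Qed.

(** * Spaces of functions and inverses on either side *)

Section Ellp.
Context {R : realType} {A : banachAlgType R[i]}.
Implicit Types (f g u v : int -> A) (p : R) (w : int -> R) (z : R[i]) (a b : A).

Lemma ellpP p w f : ellp p w f <-> exists c, sums_le (wpow p w f) c.
Proof.
rewrite /ellp /= /esum; split.
  set M := ereal_sup _ => Mfin.
  have hs s : uniq s -> ((\sum_(x <- s) wpow p w f x)%:E <= M)%E.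
    move=> us; apply: ereal_sup_ubound => /=.
    exists [set` s]; first by split=> //; exact: finite_seq.
    by rewrite -fsbig_seq// sumEFin.
  have M0 : (0 <= M)%E by have := hs [::] isT; rewrite big_nil.
  exists (fine M) => s us; rewrite -lee_fin fineK ?hs//.
  by rewrite ge0_fin_numE.
move=> [c hc]; apply: (@le_lt_trans _ _ c%:E); last exact: ltry.
apply: ge_ereal_sup => _ [F [fF _] <-].
rewrite fsbig_finite//= sumEFin lee_fin; apply: hc; exact: finmap.fset_uniq.
Qed.

Lemma ellp_summable p w f : 0 < p <= 1 -> weight w -> ellp p w f -> abs_summable f.
Proof.
by move=> p01 [w1 _] /ellpP[c hc]; exists (c `^ p^-1); exact: wpow_rnorm p01 w1 hc.
Qed.

Lemma ell1P f : ell1 f <-> abs_summable f.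
Proof. by rewrite /ell1 ellpP wpow11. Qed.

(** The windows are not invariant under the reflection, so density is used. This serves to compare
    convolutions over [A] and its opposite. *)
Lemma zsum_reflect u n : abs_summable u -> zsum (fun m => u (n - m)) = zsum u.
Proof.
have inj : injective (fun m : int => n - m) by move=> x y /addrI/oppr_inj.
have SmR v : abs_summable v -> abs_summable (fun m => v (n - m)).
  by move=> [c hc]; exists c; exact: (sums_le_inj inj hc).
move=> su; apply/eqP; rewrite -subr_eq0; apply/eqP.
apply: (@l1_density _ _ (fun u => zsum (fun m => u (n - m)) - zsum u) (1 + 1)) su.
- move=> v v' sv sv'; rewrite (zsumD sv sv') (zsumD (SmR _ sv) (SmR _ sv')).
  by rewrite opprD addrACA.
- move=> v c hc; apply: le_trans (rnormB _ _) _; rewrite mulrDl mul1r.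
  by apply: lerD; apply: zsum_le => //; exact: (sums_le_inj inj hc).
move=> i a; rewrite (@zsum1 _ _ _ (n - i)).
  by rewrite (@zsum1 _ _ _ i) ?subKr ?subrr// => m /negPf; rewrite /atom => ->.
by move=> m mni; rewrite /atom; case: eqP => // nmi; rewrite -nmi subKr eqxx in mni.
Qed.

(** Density in each argument leaves the product of two atoms. *)
Lemma fourier_conv f g z : `|z| = 1 -> abs_summable f -> abs_summable g ->
  fourier (convz f g) z = fourier f z * fourier g z.
Proof.
move=> z1 sf sg; have z0 : z != 0 by rewrite -normr_eq0 z1 oner_eq0.
apply/eqP; rewrite -subr_eq0; apply/eqP.
have [c hc] := sg.
apply: (@l1_density _ _
  (fun u => fourier (convz u g) z - fourier u z * fourier g z) (c + c)) sf.
- move=> u v su sv; rewrite (convzDl su sv sg) (fourierD z1 su sv).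
  rewrite (fourierD z1 (convz_summable su sg) (convz_summable sv sg)).
  by rewrite mulrDl opprD addrACA.
- move=> u d hd; apply: le_trans (rnormB _ _) _; rewrite [leRHS]mulrDl; apply: lerD.
    by rewrite mulrC; apply: fourier_le => //; exact: convz_sums_le.
  apply: le_trans (rnormM _ _) _; rewrite mulrC.
  by apply: ler_pM; rewrite ?rnorm_ge0//; exact: fourier_le.
move=> i a; apply: (@l1_density _ _
  (fun v => fourier (convz (atom i a) v) z - fourier (atom i a) z * fourier v z)
  (rnorm a + rnorm a)) sg.
- move=> u v su sv; have sa := atom_summable i a.
  rewrite (convzDr sa su sv) (fourierD z1 su sv).
  rewrite (fourierD z1 (convz_summable sa su) (convz_summable sa sv)).
  by rewrite mulrDr opprD addrACA.
- move=> u d hd; apply: le_trans (rnormB _ _) _; rewrite [leRHS]mulrDl; apply: lerD.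
    by apply: fourier_le => //; apply: convz_sums_le => //; exact: sums_le_atom.
  apply: le_trans (rnormM _ _) _.
  apply: ler_pM; rewrite ?rnorm_ge0//; apply: fourier_le => //; exact: sums_le_atom.
move=> j b; have -> : convz (atom i a) (atom j b) = atom (i + j) (a * b).
  rewrite convz_atom; apply/funext => n; rewrite /atom subr_eq addrC.
  by case: eqP => // _; rewrite mulr0.
by rewrite !fourier_atom expfzDr// -scalerAl -scalerAr scalerA subrr.
Qed.

End Ellp.

(* A right inverse over [A] is a left inverse over the opposite algebra. *)
Definition opalg (R : realType) (A : banachAlgType R[i]) : Type := A.

Section Opposite.
Context {R : realType} {A : banachAlgType R[i]}.

HB.instance Definition _ := CompleteNormedModule.on (opalg A).

Fact op_mulA : associative (fun x y : opalg A => bmul (y : A) x : opalg A).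
Proof. by move=> x y z /=; rewrite bmulA. Qed.
Fact op_mul1x : left_id (bone : A) (fun x y : opalg A => bmul (y : A) x : opalg A).
Proof. by move=> x /=; exact: bmulx1. Qed.
Fact op_mulx1 : right_id (bone : A) (fun x y : opalg A => bmul (y : A) x : opalg A).
Proof. by move=> x /=; exact: bmul1x. Qed.
Fact op_mulDl : left_distributive (fun x y : opalg A => bmul (y : A) x : opalg A) +%R.
Proof. by move=> x y z /=; exact: bmulDr. Qed.
Fact op_mulDr : right_distributive (fun x y : opalg A => bmul (y : A) x : opalg A) +%R.
Proof. by move=> x y z /=; exact: bmulDl. Qed.
Fact op_one_neq0 : (bone : opalg A) != 0.
Proof. exact: bone_neq0. Qed.
Fact op_scaleAl (k : R[i]) (x y : opalg A) :
  k *: (bmul (y : A) x : opalg A) = bmul (y : A) (k *: x : opalg A).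
Proof. exact: bscaleAr. Qed.
Fact op_scaleAr (k : R[i]) (x y : opalg A) :
  k *: (bmul (y : A) x : opalg A) = bmul (k *: y : opalg A) (x : A).
Proof. exact: bscaleAl. Qed.
Fact op_normM_le (x y : opalg A) : `|bmul (y : A) x : opalg A| <= `|x| * `|y|.
Proof. by rewrite mulrC; exact: bnormM_le. Qed.

HB.instance Definition _ := CompleteNormedModule_isBanachAlgebra.Build R[i]
  (opalg A) op_mulA op_mul1x op_mulx1 op_mulDl op_mulDr op_one_neq0
  op_scaleAl op_scaleAr op_normM_le.

End Opposite.

Section Sides.
Context {R : realType}.
Implicit Types (p : R) (w : int -> R).

Lemma left_wiener (A : banachAlgType R[i]) p w (f : int -> A) :
  0 < p <= 1 -> weight w -> ellp p w f ->
  (forall z : R[i], `|z| = 1 -> exists a : A, a * fourier f z = 1) ->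
  exists2 beta, 1 < beta & forall nu, weight nu -> (forall x, nu x <= w x) ->
    (exists C, forall x, nu x <= C * beta ^+ `|x|%N) ->
    exists2 g : int -> A, ellp p nu g & convz g f = delta0.
Proof.
move=> p01 ww pf hf; have sf := ellp_summable p01 ww pf.
have ff : in_lp p w (MkL1 sf) by apply/ellpP.
have [beta b1 h] := weighted_wiener p01 ww ff hf.
exists beta => // nu wn nw hC; have [g fg gf] := h nu wn nw hC.
exists g; first exact/ellpP.
by have := congr1 (@l1v _ _) gf.
Qed.

Lemma right_wiener (A : banachAlgType R[i]) p w (f : int -> A) :
  0 < p <= 1 -> weight w -> ellp p w f ->
  (forall z : R[i], `|z| = 1 -> exists a : A, fourier f z * a = 1) ->
  exists2 beta, 1 < beta & forall nu, weight nu -> (forall x, nu x <= w x) ->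
    (exists C, forall x, nu x <= C * beta ^+ `|x|%N) ->
    exists2 g : int -> A, ellp p nu g & convz f g = delta0.
Proof.
move=> p01 ww pf hf.
have [beta b1 h] := @left_wiener (opalg A) p w f p01 ww pf hf.
exists beta => // nu wn nw hC; have [g pg gf] := h nu wn nw hC.
exists g; first exact: pg.
have sf := ellp_summable p01 ww pf.
have sg : abs_summable (g : int ->
  A) by exact: (@ellp_summable _ (opalg A) p nu g p01 wn pg).
(* Over the opposite algebra, convolving [g] with [f] sums f(m) g(n - m); the reflection of m into n
   - m gives the convolution of [f] with [g] over [A]. *)
apply/funext => n; rewrite -[RHS](congr1 (@^~ n) gf) /convz.
rewrite -(zsum_reflect n (convz_terms_summable n sf sg)).
by congr zsum; apply/funext => m; rewrite subKr.
Qed.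

End Sides.

Lemma two_sided_wiener (R : realType) (A : banachAlgType R[i]) (s : side) p w (f : int -> A) :
  0 < p <= 1 -> weight w -> ellp p w f ->
  (forall z : R[i], `|z| = 1 -> exists a : A, is_inverse s *%R 1 a (fourier f z)) ->
  exists2 beta, 1 < beta & forall nu, weight nu -> (forall x, nu x <= w x) ->
    (exists C, forall x, nu x <= C * beta ^+ `|x|%N) ->
    exists2 g : int -> A, ellp p nu g & is_inverse s convz delta0 g f.
Proof.
move=> p01 ww pf; case: s => /= hf.
- exact: left_wiener.
- exact: right_wiener.
have [b1 b11 h1] : exists2 beta, 1 < beta & forall nu, weight nu ->
  (forall x, nu x <= w x) ->
    (exists C, forall x, nu x <= C * beta ^+ `|x|%N) ->
    exists2 g : int -> A, ellp p nu g & convz g f = delta0.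
  by apply: left_wiener => // z /hf[a [? _]]; exists a.
have [b2 b21 h2] : exists2 beta, 1 < beta & forall nu, weight nu ->
  (forall x, nu x <= w x) ->
    (exists C, forall x, nu x <= C * beta ^+ `|x|%N) ->
    exists2 g : int -> A, ellp p nu g & convz f g = delta0.
  by apply: right_wiener => // z /hf[a [_ ?]]; exists a.
(* Growth below both thresholds gives an inverse on each side; associativity in l^1 makes the two
   equal. *)
exists (Num.min b1 b2); first by rewrite lt_min b11.
move=> nu wn nw [C hC].
have C0 : 0 <= C.
  have [n1 _] := wn; have := hC 0; rewrite expr0 mulr1.
  by move=> /(le_trans (n1 0)); apply: le_trans.
have b0 : 0 <= Num.min b1 b2 by rewrite le_min !(le_trans ler01)// ltW.
have weaken b : Num.min b1 b2 <= b -> exists C, forall x, nu x <= C * b ^+ `|x|%N.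
  move=> mb; exists C => x; apply: le_trans (hC x) _; rewrite ler_wpM2l//.
  by rewrite lerXn2r ?nnegrE// (le_trans b0).
have [g1 pg1 e1] : exists2 g : int -> A, ellp p nu g & convz g f = delta0.
  by apply: h1 => //; apply: weaken; rewrite ge_min lexx.
have [g2 pg2 e2] : exists2 g : int -> A, ellp p nu g & convz f g = delta0.
  by apply: h2 => //; apply: weaken; rewrite ge_min lexx orbT.
exists g1 => //; split=> //.
suff -> : g1 = g2 by [].
rewrite -[LHS]convz1 -e2 convzA;
  [|exact: ellp_summable pg1|exact: ellp_summable pf|exact: ellp_summable pg2].
by rewrite e1 conv1z.
Qed.

(** * Algebras of Type-II *)

Section TypeII.
Context {R : realType} {A : banachAlgType R[i]}.
Implicit Types (f g : int -> A).

(** A p'-th power is the p-th power times its own power of exponent p'/p - 1 >= 0, and the latter is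
    bounded because each term is at most the whole sum. *)
Lemma ellp_sub p p' (w w' : int -> R) : 0 < p <= 1 -> weight w -> weight w' ->
  p <= p' <= 1 -> (forall x, w' x <= w x) ->
  (ellp p w : set (int -> A)) `<=` ellp p' w'.
Proof.
move=> p01 ww ww' /andP[pp' p'1] w'w f /ellpP[c hc]; apply/ellpP.
have /andP[p0 p1] := p01.
have w'1 x : 1 <= w' x by case: ww'.
have c0 := sums_le_ge0 hc.
exists (c `^ (p' / p - 1) * c).
have pq : 0 <= p' / p - 1 by rewrite subr_ge0 ler_pdivlMr// mul1r.
apply: sums_le_mono (sbdZ (powR_ge0 _ _) hc) => x.
have w0 y : 0 <= w' y by apply: le_trans (w'1 y).
have rw0 : 0 <= rnorm (f x) * w' x by rewrite mulr_ge0 ?rnorm_ge0.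
have phw : (rnorm (f x) * w' x) `^ p <= wpow p w f x.
  rewrite powRM ?rnorm_ge0// /wpow ler_wpM2l ?powR_ge0//.
  by rewrite ge0_ler_powR ?nnegrE ?(ltW p0)// (le_trans (w0 x)).
rewrite {1}/wpow -powRM ?rnorm_ge0//.
have -> : (rnorm (f x) * w' x) `^ p' =
    ((rnorm (f x) * w' x) `^ p) `^ (p' / p - 1) * (rnorm (f x) * w' x) `^ p.
  rewrite -powRrM -powRD; first by congr (_ `^ _);
    rewrite mulrBr mulrCA divff ?gt_eqF// !mulr1 subrK.
  by apply/implyP => /eqP; have := mulr_ge0 (ltW p0) pq; lra.
apply: ler_pM; rewrite ?powR_ge0//.
rewrite ge0_ler_powR ?nnegrE ?powR_ge0//.
by apply: le_trans phw _; exact: sums_le_pt.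
Qed.

Lemma typeII_le p w : typeII_family p w -> forall n m, (n <= m)%N ->
  p n <= p m /\ forall x, w m x <= w n x :> R.
Proof.
move=> [p01 pS ww wS] n m /subnKC <-; elim: (m - n)%N => [|k [IHp IHw]].
  by rewrite addn0.
rewrite addnS; split; first exact: le_trans (pS _).
by move=> x; apply: le_trans (wS _ _) _.
Qed.

Lemma typeII_sub p w : typeII_family p w -> forall n m, (n <= m)%N ->
  (ellp (p n) (w n) : set (int -> A)) `<=` ellp (p m) (w m).
Proof.
move=> pw n m nm; have [pnm wnm] := typeII_le pw nm.
have [p01 _ ww _] := pw.
by apply: ellp_sub => //; rewrite pnm; case/andP: (p01 m).
Qed.

Lemma ellp_atom p w i (a : A) : 0 < p <= 1 -> ellp p w (atom i a).
Proof. by move=> p01; apply/ellpP; eexists; exact: (lp_le_atom w p01 i a). Qed.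

(** The union is increasing, so two elements lie in a common space, and each space is closed under
    the operations. *)
Lemma typeII_subalgebra p w : typeII_family p w ->
  subalgebra (ell_union p w : set (int -> A)).
Proof.
move=> pw; have [p01 _ ww _] := pw.
have both f g : ell_union p w f -> ell_union p w g ->
    exists n, ellp (p n) (w n) f /\ ellp (p n) (w n) g.
  move=> [n _ hf] [m _ hg]; exists (maxn n m).
  by split; [apply: (typeII_sub pw (leq_maxl _ _))|apply: (typeII_sub pw (leq_maxr _ _))].
split.
- by move=> f [n _ hf]; apply/ell1P; exact: ellp_summable hf.
- by exists 0%N => //; exact: ellp_atom.
- move=> f g Xf Xg; have [n [/ellpP[c hc] /ellpP[d hd]]] := both f g Xf Xg.
  exists n => //.
  apply/ellpP; exists (c + d); apply: sums_le_mono (sbdD hc hd) => x; exact: wpowD.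
- move=> z f [n _ /ellpP[c hc]]; exists n => //; apply/ellpP.
  exists (cabs z `^ p n * c); apply: sums_le_mono (sbdZ (powR_ge0 _ _) hc) => x.
  by rewrite /wpow rnormZ powRM ?cabs_ge0 ?rnorm_ge0// mulrA.
move=> f g Xf Xg; have [n [hf hg]] := both f g Xf Xg.
exists n; first by [].
apply/ellpP.
have [w1 wM] := ww n.
have sf := ellp_summable (p01 n) (ww n) hf; have sg :=
  ellp_summable (p01 n) (ww n) hg.
move: hf hg => /ellpP[c hc] /ellpP[d hd].
by exists (c * d); exact: convz_wpow.
Qed.

End TypeII.

(** * Growth rates and roots of weights *)

Section Submultiplicative.
Context {R : realType}.
Implicit Types (a : nat -> R).

Lemma root_cvg1 (D : R) : 1 <= D -> (fun k : nat => D `^ k%:R^-1) @ \oo --> (1 : R).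
Proof.
move=> D1; have D0 : 0 < D by apply: lt_le_trans D1.
have -> : (fun k : nat => D `^ k%:R^-1) = (fun k : nat => expR (k%:R^-1 * ln D)).
  by apply/funext => k; rewrite /powR gt_eqF.
have e1 : expR (0 * ln D) = 1 by rewrite mul0r expR0.
rewrite -[X in _ --> X]e1.
apply: continuous_cvg; first exact: continuous_expR.
apply: cvgM; last exact: cvg_cst.
apply/cvgrPdist_le => e e0.
exists (Num.truncn e^-1).+1 => // k /= hk.
have k0 : 0 < k%:R :> R by rewrite ltr0n; apply: leq_trans hk.
rewrite sub0r normrN ger0_norm ?invr_ge0 ?(ltW k0)//
  -[e]invrK lef_pV2 ?posrE ?invr_gt0//.
by apply: le_trans (ltW (truncnS_gt _)) _; rewrite ler_nat.
Qed.

Definition roots a (k : nat) : R := a k `^ k%:R^-1.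

Lemma rootsK a k : (forall n, 1 <= a n) -> (0 < k)%N -> roots a k ^+ k = a k.
Proof.
move=> a1 k0; rewrite /roots -powR_mulrn ?powR_ge0// -powRrM mulVf ?powRr1//.
  exact: le_trans (a1 k).
by rewrite pnatr_eq0 -lt0n.
Qed.

Lemma roots_ge1 a k : (forall n, 1 <= a n) -> 1 <= roots a k.
Proof. by move=> a1; apply: powR_ge1. Qed.

(** Fekete's lemma in multiplicative form. The limit is the infimum of the roots, whence the lower
    bound on every [a k]. *)
Lemma fekete a : (forall n, 1 <= a n) -> (forall m n, a (m + n)%N <= a m * a n) ->
  exists l : R, [/\ roots a @ \oo --> l, 1 <= l & forall k, l ^+ k <= a k].
Proof.
move=> a1 aM.
have r1 k := roots_ge1 k a1.
(* Index 0 is left out: with 0^-1 = 0, [roots a 0] is 1 and would spoil the infimum. *)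
pose S : set R := [set roots a k.+1 | k in [set: nat]].
have S1 : lbound S 1 by move=> _ [k _ <-].
have S0 : S !=set0 by exists (roots a 1); exists 0%N.
have hS : has_inf S by split=> //; exists 1.
exists (inf S).
have l1 : 1 <= inf S by apply: lb_le_inf.
have lr k : (0 < k)%N -> inf S <= roots a k.
  by case: k => // k _; apply: ge_inf; [exists 1|exists k].
split=> //; last first.
  case=> [|k]; first by rewrite expr0.
  rewrite -(rootsK a1 (ltn0Sn k)) lerXn2r ?nnegrE ?lr//.
    exact: le_trans l1.
  by rewrite (le_trans ler01).
apply/cvgrPdist_le => e e0; have e2 : 0 < e / 2 by rewrite divr_gt0.
have [_ [N _ <-] hN] := inf_adherent e2 hS.
set M := N.+1 in hN; set b := inf S + e / 2 in hN.
have b1 : 1 <= b by rewrite /b; lra.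
have b0 : 0 < b by apply: lt_le_trans b1.
have aMb : a M <= b ^+ M.
  rewrite -(rootsK a1 (ltn0Sn N)) lerXn2r ?nnegrE ?(ltW b0) ?(ltW hN)//.
  by rewrite (le_trans ler01).
pose D := \sum_(i < M) a i.
have aD i : (i < M)%N -> a i <= D.
  move=> iM; rewrite /D (bigD1 (Ordinal iM))//= lerDl sumr_ge0// => j _.
  exact: le_trans (a1 _).
have D1 : 1 <= D by apply: le_trans (aD 0%N _).
have aqM q : a (q * M)%N <= D * b ^+ (q * M).
  elim: q => [|q IH]; first by rewrite mul0n expr0 mulr1 aD.
  rewrite mulSn addnC; apply: le_trans (aM _ _) _; rewrite exprD mulrA.
  by apply: ler_pM => //; exact: le_trans (a1 _).
(* In k = q M + r, one factor [D] bounds a(r) and the other comes from the start q = 0 of [aqM];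
   k-th roots make both disappear in the limit. *)
have ak k : a k <= (D * D) * b ^+ k.
  rewrite {1}(divn_eq k M); apply: le_trans (aM _ _) _.
  rewrite -mulrA mulrC; apply: ler_pM; rewrite ?(le_trans ler01 (a1 _))//.
    by rewrite aD// ltn_mod.
  apply: le_trans (aqM _) _; rewrite ler_wpM2l ?(le_trans ler01)//.
  by rewrite ler_weXn2l// leq_divM.
have DD1 : 1 <= D * D by rewrite -[leLHS]mulr1 ler_pM.
have c0 : 0 < e / 2 / b by rewrite divr_gt0.
have /cvgrPdist_le/(_ _ c0) hD := root_cvg1 DD1.
near=> k; have k0 : (0 < k)%N by near: k; exists 1%N.
rewrite distrC ger0_norm ?subr_ge0 ?lr// lerBlDl.
have : roots a k <= (D * D) `^ k%:R^-1 * b.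
  have -> : (D * D) `^ k%:R^-1 * b = ((D * D) * b ^+ k) `^ k%:R^-1.
    rewrite [RHS]powRM ?exprn_ge0 ?(ltW b0) ?(le_trans ler01 DD1)//.
    rewrite -[b ^+ k]powR_mulrn ?(ltW b0)// -powRrM mulfV ?pnatr_eq0 -?lt0n//
      powRr1 ?(ltW b0)//.
  have ak0 : 0 <= a k by apply: le_trans (a1 k).
  by rewrite /roots ge0_ler_powR ?nnegrE ?invr_ge0 ?ler0n// (le_trans ak0).
move=> /le_trans; apply.
have : (D * D) `^ k%:R^-1 - 1 <= e / 2 / b.
  apply: le_trans (ler_norm _) _; rewrite distrC; near: k; exact: hD.
rewrite ler_pdivlMr// mulrBl mul1r lerBlDr => /le_trans; apply.
rewrite /b; lra.
Unshelve. all: by end_near. Qed.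

(** From some rank on the roots are below [beta]; the finitely many earlier values go into [C]. *)
Lemma roots_lt_bound a (l beta : R) : (forall n, 1 <= a n) -> roots a @ \oo --> l ->
  l < beta -> 1 <= beta -> exists C, forall k, a k <= C * beta ^+ k.
Proof.
move=> a1 rl lb b1.
have [K _ hK] : \forall k \near \oo, roots a k < beta by exact: (cvgr_lt l).
have S0 (s : nat) : 0 <= \sum_(i < s) a i.
  by rewrite sumr_ge0// => i _; exact: le_trans (a1 _).
exists (1 + \sum_(i < K.+1) a i) => k; case: (ltnP k K.+1) => kK.
  apply: (@le_trans _ _ (\sum_(i < K.+1) a i)).
    rewrite (bigD1 (Ordinal kK))//= lerDl sumr_ge0// => i _.
    exact: le_trans (a1 _).
  rewrite -[leLHS]mulr1; apply: ler_pM; rewrite ?exprn_ege1//; lra.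
have k0 : (0 < k)%N by apply: leq_trans kK.
rewrite -(rootsK a1 k0) -[leLHS]mul1r; apply: ler_pM => //.
- by rewrite exprn_ge0// (le_trans ler01)// roots_ge1.
- by have := S0 K.+1; lra.
rewrite lerXn2r ?nnegrE ?(le_trans ler01 b1) ?(le_trans ler01 (roots_ge1 k a1))//.
by apply/ltW/hK => /=; exact: ltnW.
Qed.

End Submultiplicative.

Section RootWeight.
Context {R : realType}.
Implicit Types (w : int -> R) (k : nat).

Definition rootw k w : int -> R := fun x => w x `^ k%:R^-1.

Lemma rootw_K k w x : weight w -> (0 < k)%N -> rootw k w x ^+ k = w x.
Proof.
move=> [w1 _] k0; rewrite /rootw -powR_mulrn ?powR_ge0// -powRrM mulVf ?powRr1//.
  exact: le_trans (w1 x).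
by rewrite pnatr_eq0 -lt0n.
Qed.

Lemma rootw_ge1 k w x : weight w -> 1 <= rootw k w x.
Proof. by move=> [w1 _]; apply: powR_ge1. Qed.

Lemma rootw_le k w x : weight w -> (0 < k)%N -> rootw k w x <= w x.
Proof.
move=> ww k0; rewrite -[leRHS](rootw_K x ww k0).
by rewrite ler_eXnr// rootw_ge1.
Qed.

Lemma rootw_weight k w : weight w -> weight (rootw k w).
Proof.
move=> ww; split=> [x|x y]; first exact: rootw_ge1.
have [w1 wM] := ww; have w0 x' : 0 <= w x' by apply: le_trans (w1 x').
by rewrite /rootw -powRM// ge0_ler_powR ?nnegrE ?invr_ge0 ?mulr_ge0.
Qed.

Lemma rootw_mono k w w' : weight w -> weight w' -> (forall x, w x <= w' x) ->
  forall x, rootw k w x <= rootw k w' x.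
Proof.
move=> [w1 _] [w'1 _] ww' x.
have w0 : 0 <= w x by apply: le_trans (w1 x).
have w'0 : 0 <= w' x by apply: le_trans (w'1 x).
by rewrite /rootw ge0_ler_powR ?nnegrE ?invr_ge0.
Qed.

Lemma rootw_constant k w : weight w -> (0 < k)%N ->
  constant_weight (rootw k w) <-> constant_weight w.
Proof.
move=> ww k0; split=> -[c hc]; last by exists (c `^ k%:R^-1) => x; rewrite /rootw hc.
by exists (c ^+ k) => x; rewrite -(hc x) rootw_K.
Qed.

(** One direction raises the limit 1 to the k-th power; in the other the roots are squeezed between
    1 and those of [w]. *)
Lemma rootw_admissible k w : weight w -> (0 < k)%N ->
  admissible (rootw k w) <-> admissible w.
Proof.
move=> ww k0; have wr := rootw_weight k ww.
have [w1 _] := ww; have [r1 _] := wr.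
have w0 x : 0 <= w x by apply: le_trans (w1 x).
split=> h m.
  have -> : (fun n : nat => w (n%:Z * m) `^ n%:R^-1) =
      (fun n : nat => (rootw k w (n%:Z * m) `^ n%:R^-1) ^+ k).
    apply/funext => n; rewrite -(rootw_K (n%:Z * m) ww k0).
    by rewrite powR_expr// (le_trans ler01).
  rewrite -[X in _ --> X](expr1n R k).
  have hm : (fun n : nat => rootw k w (n%:Z * m) `^ n%:R^-1) @ \oo --> (1 : R) := h m.
  apply: (cvg_comp _ (fun x : R => x ^+ k) hm); exact: exprn_continuous.
apply: (@squeeze_cvgr _ _ _ _ (fun=> 1) (fun n : nat => w (n%:Z * m) `^ n%:R^-1)).
- near=> n; apply/andP; split; first exact: powR_ge1.
  have r0 : 0 <= rootw k w (n%:Z * m) by apply: le_trans (r1 _).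
  by rewrite ge0_ler_powR ?nnegrE ?invr_ge0// rootw_le.
- exact: cvg_cst.
- exact: h.
Unshelve. all: by end_near. Qed.

Lemma weight_exp_bound w : weight w ->
  exists C B, [/\ 1 <= C, 1 <= B & forall x, w x <= C * B ^+ `|x|%N].
Proof.
move=> [w1 wM]; have w0 x : 0 <= w x by apply: le_trans (w1 x).
pose B := Num.max (w 1) (w (-1)).
have B1 : 1 <= B by rewrite le_max w1.
have B0 : 0 <= B by apply: le_trans B1.
exists (w 0), B; split=> //.
have key (e : int) : w e <= B -> forall n : nat, w (n%:Z * e) <= w 0 * B ^+ n.
  move=> eB; elim=> [|n IH]; first by rewrite mul0r expr0 mulr1.
  have -> : n.+1%:Z * e = n%:Z * e + e by rewrite -addn1 PoszD mulrDl mul1r.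
  by apply: le_trans (wM _ _) _; rewrite exprSr mulrA ler_pM.
case=> n.
  by have := key 1 _ n; rewrite mulr1; apply; rewrite /B le_max lexx.
have := key (-1) _ n.+1; rewrite mulrN1 NegzE abszN; apply.
by rewrite /B le_max lexx orbT.
Qed.

End RootWeight.

Lemma expn_unbounded (R : realType) (b c : R) : 1 < b -> ~ (forall k, b ^+ k <= c).
Proof.
move=> b1 h; have b0 : 0 < b by apply: lt_trans b1.
have : (fun k => b^-1 ^+ k) @ \oo --> (0 : R).
  by apply: cvg_expr; rewrite ger0_norm ?invr_ge0 ?ltW// invf_lt1.
have c0 : 0 < c by apply: lt_le_trans (h 0%N).
have ci : 0 < c^-1 / 2 by rewrite divr_gt0// invr_gt0.
move=> /cvg0_small/(_ ci)[N /(_ N (leqnn N))]; rewrite exprVn => h1.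
have : c^-1 <= (b ^+ N)^-1 by rewrite lef_pV2 ?posrE ?exprn_gt0.
by move: ci; lra.
Qed.

Lemma weight_roots (R : realType) (w : int -> R) (m : int) : weight w ->
  exists l : R, [/\ (fun k : nat => w (k%:Z * m) `^ k%:R^-1) @ \oo --> l, 1 <= l &
    forall k : nat, l ^+ k <= w (k%:Z * m)].
Proof.
move=> [w1 wM]; apply: (@fekete _ (fun k : nat => w (k%:Z * m))) => // k n.
by rewrite PoszD mulrDl.
Qed.

(** * Inverse-closedness and the extended GRS condition *)

Section InverseClosed.
Context {R : realType} {A : banachAlgType R[i]}.
Variables (p : nat -> R) (w : nat -> int -> R).
Hypothesis pw : typeII_family p w.

Let lim_w n (m : int) := limn (fun k : nat => w n (k%:Z * m) `^ k%:R^-1).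

Lemma limw_spec n m : [/\ (fun k : nat => w n (k%:Z * m) `^ k%:R^-1) @ \oo --> lim_w n m,
   1 <= lim_w n m & forall k : nat, lim_w n m ^+ k <= w n (k%:Z * m)].
Proof.
have [_ _ ww _] := pw; have [l [h1 h2 h3]] := weight_roots m (ww n).
by have -> : lim_w n m = l by apply: cvg_lim.
Qed.

Let has_infS m : has_inf [set lim_w n m | n in [set: nat]].
Proof.
split; first by exists (lim_w 0%N m); exists 0%N.
by exists 1 => _ [n _ <-]; have [] := limw_spec n m.
Qed.

(** The infima at m = 1 and m = -1 give weights growing at most like powers of [beta] on each
    half-line. As the weights decrease, one index n >= j serves both, and [w n] itself plays the
    role of [nu]. *)
Lemma GRS_inverse_closed : extended_GRS w ->
  inverse_closed (ell_union p w : set (int -> A)).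
Proof.
move=> grs; have [p01 _ ww _] := pw; split; first exact: typeII_subalgebra.
move=> f [j _ fj] [g0 /ell1P sg0 [e1 e2]].
have sf := ellp_summable (p01 j) (ww j) fj.
have [z zn|beta b1 h] := @two_sided_wiener _ A TwoSidedInv _ _ f (p01 j) (ww j) fj.
  exists (fourier g0 z); split.
    by rewrite -fourier_conv// e1 fourier_atom expr0z scale1r.
  by rewrite -fourier_conv// e2 fourier_atom expr0z scale1r.
have bnd_m m : exists n C, forall n', (n <= n')%N -> forall k : nat,
    w n' (k%:Z * m) <= C * beta ^+ k.
  have e0 : 0 < beta - 1 by rewrite subr_gt0.
  have [_ [n _ <-]] := inf_adherent e0 (has_infS m).
  have -> : inf [set lim_w n m | n in [set: nat]] = 1 by exact: grs.
  rewrite addrC subrK => lb; have [hl _ _] := limw_spec n m.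
  have [w1 _] := ww n.
  have [C hC] := roots_lt_bound (a :=
    fun k : nat => w n (k%:Z * m)) (fun k => w1 _) hl lb (ltW b1).
  exists n, C => n' nn' k; apply: le_trans (hC k).
  by have [_ ->] := typeII_le pw nn'.
have [n1 [C1 h1]] := bnd_m 1; have [n2 [C2 h2]] := bnd_m (-1).
pose n := maxn j (maxn n1 n2).
have [||g pg ig] := h (w n) (ww n).
- by have [_ ?] := typeII_le pw (leq_maxl j (maxn n1 n2)).
- exists (`|C1| + `|C2|); case=> k /=.
    have := h1 n _ k; rewrite mulr1 => /(_ _)/le_trans; apply.
      by rewrite /n !leq_max leqnn orbT.
    rewrite ler_wpM2r ?exprn_ge0 ?(le_trans ler01 (ltW b1))//.
    by apply: le_trans (ler_norm _) _; rewrite lerDl.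
  have := h2 n _ k.+1; rewrite mulrN1 -NegzE => /(_ _)/le_trans; apply.
    by rewrite /n !leq_max leqnn !orbT.
  rewrite ler_wpM2r ?exprn_ge0 ?(le_trans ler01 (ltW b1))//.
  by apply: le_trans (ler_norm _) _; rewrite lerDr.
exists g; last by [].
exists n; first by [].
have [pjn _] := typeII_le pw (leq_maxl j (maxn n1 n2)).
apply: (ellp_sub (p01 j) (ww n) (ww n) _ _ pg) => //.
by rewrite pjn; case/andP: (p01 n).
Qed.

(** If the infimum rho at m exceeds 1, take 1/rho < t < 1 and the element with 1 at 0 and -t at m.
    Its inverse has t^k at k m, where every weight is at least rho^k, so the inverse lies in none of
    the spaces. *)
Lemma inverse_closed_GRS : inverse_closed (ell_union p w : set (int -> A)) ->
  extended_GRS w.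
Proof.
move=> [[_ X1 XD _ _] ic] m; have [p01 _ ww _] := pw.
pose S := [set lim_w n m | n in [set: nat]]; rewrite -/S.
have S1 : 1 <= inf S.
  apply: lb_le_inf; first by exists (lim_w 0%N m); exists 0%N.
  by move=> _ [n _ <-]; have [] := limw_spec n m.
apply/eqP; rewrite eq_le S1 andbT leNgt; apply/negP => S1'.
set rho := inf S in S1 S1'.
have wrho n k : rho ^+ k <= w n (k%:Z * m).
  have [_ l1 lk] := limw_spec n m; apply: le_trans (lk k).
  rewrite lerXn2r ?nnegrE ?(le_trans ler01)//.
  by apply: ge_inf; [exact: (has_infS m).2|exists n].
(* A number strictly between 1 / rho and 1. *)
pose t : R := 2 / (1 + rho).
have r0 : 0 < 1 + rho by lra.
have t0 : 0 < t by rewrite divr_gt0.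
have t1 : t < 1 by rewrite ltr_pdivrMr//; lra.
have tr : 1 < t * rho by rewrite mulrAC ltr_pdivlMr//; lra.
pose f : int -> A := fun x => delta0 x + atom m (- (t%:C *: 1)) x.
have Xat : ell_union p w (atom m (- (t%:C *: 1) : A)).
  by exists 0%N; [|exact: ellp_atom].
have Xf : ell_union p w f by exact: XD X1 Xat.
have sf : abs_summable f by apply: abs_summableD; exact: atom_summable.
have p1 : 0 < (1 : R) <= 1 by rewrite ltr01 lexx.
have w1 := one_weight_weight R.
have [g g1 ig] : exists2 g : int ->
  A, ell1 g & is_inverse TwoSidedInv convz delta0 g f.
  have [||beta b1 h] := @two_sided_wiener _ A TwoSidedInv 1 one_weight f p1 w1.
  - exact/ell1P.
  - move=> z z1; pose c : R[i] := 1 - z ^ m * t%:C.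
    have fz : fourier f z = c *: 1.
      rewrite /f fourierD//; [|exact: atom_summable..].
      by rewrite !fourier_atom expr0z scale1r scalerN scalerA /c scalerBl scale1r.
    have c0 : c != 0.
      rewrite subr_eq0; apply/eqP => /(congr1 (@cabs R)).
      rewrite cabsM cabs_exprz// mul1r cabs_real cabs1 ?normr1// gtr0_norm// => e.
      by move: t1; rewrite -e ltxx.
    exists (c^-1 *: 1); rewrite fz /= -!scalerAl !mul1r !scalerA.
    by rewrite mulVf// mulfV// scale1r.
  apply: (h one_weight) => //; exists 1 => x.
  by rewrite mul1r /one_weight exprn_ege1// ltW.
have [h [n _ hn] [_ fh]] := ic f Xf (ex_intro2 _ _ g g1 ig).
have sh := ellp_summable (p01 n) (ww n) hn.
have rec x : h x - t%:C *: h (x - m) = delta0 x.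
  rewrite -fh /f convzDl//; [|exact: atom_summable..].
  by rewrite conv1z convz_atom mulNr -scalerAl mul1r.
have /ellpP[c hc] := hn; have /andP[p0 _] := p01 n.
have c0 := sums_le_ge0 hc.
have grow : 0 < rnorm (1 : A).
  rewrite lt_neqAle rnorm_ge0 andbT eq_sym; apply/eqP => /rnorm_eq0/eqP.
  by rewrite oner_eq0.
(* For m = 0 all powers of rho would be bounded by a single value of the weight. *)
have [m0|m0] := eqVneq m 0.
  apply: (@expn_unbounded _ rho (w 0%N 0)) => // k.
  by have := wrho 0%N k; rewrite m0 mulr0.
have rec' x : x != 0 -> h x = t%:C *: h (x - m).
  by move=> /negPf x0; have := rec x; rewrite /delta0 x0 => /eqP;
    rewrite subr_eq0 => /eqP.
have nzm (k : nat) : k.+1%:Z * m != 0 by rewrite mulf_neq0.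
have tabs : cabs (t%:C) = t by rewrite cabs_real gtr0_norm.
(* Followed backwards, the recurrence multiplies the norm by 1 / t > 1 at each step, so a summable
   [h] must vanish at -m. This forces [h 0 = 1]. *)
have hm : h (- m) = 0.
  have back k : rnorm (h (- m)) = t ^+ k * rnorm (h (- (k.+1%:Z * m))).
    elim: k => [|k IH]; first by rewrite expr0 !mul1r.
    rewrite IH [h (- (k.+1%:Z * m))]rec' ?oppr_eq0// rnormZ tabs exprSr -mulrA.
    by congr (_ * (_ * rnorm (h _))); rewrite [k.+2%:Z]intS mulrDl mul1r opprD addrC.
  have [d hd] := sh; have d0 := sums_le_ge0 hd.
  apply: rnorm_eq0; apply/eqP; rewrite eq_le rnorm_ge0 andbT leNgt; apply/negP => hp.
  apply: (@expn_unbounded _ t^-1 (d / rnorm (h (- m)))).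
    by rewrite invf_gt1.
  move=> k; rewrite ler_pdivlMr// exprVn ler_pdivrMl ?exprn_gt0// (back k).
  by rewrite ler_wpM2l ?exprn_ge0 ?(ltW t0)//; exact: (sums_le_pt _ hd).
have h0 : h 0 = 1.
  by have := rec 0; rewrite sub0r hm scaler0 subr0 /delta0 eqxx.
have hk (k : nat) : rnorm (h (k%:Z * m)) = t ^+ k * rnorm (1 : A).
  elim: k => [|k IH]; first by rewrite mul0r h0 expr0 mul1r.
  rewrite rec'// rnormZ tabs exprS -mulrA -IH; congr (_ * rnorm (h _)).
  by rewrite intS; ring.
(* A single term of the weighted sum already bounds (t rho)^k uniformly in k. *)
apply: (@expn_unbounded _ (t * rho) (c `^ (p n)^-1 / rnorm (1 : A))) => // k.
rewrite ler_pdivlMr// exprMn.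
have := sums_le_pt (k%:Z * m) hc; rewrite /wpow hk.
have [wn1 _] := ww n.
have wk0 : 0 <= w n (k%:Z * m) by apply: le_trans (wn1 _).
have tk0 : 0 <= t ^+ k * rnorm (1 : A) by rewrite mulr_ge0 ?exprn_ge0 ?(ltW t0) ?rnorm_ge0.
rewrite -powRM//; set X := _ * w n _ => hp; have X0 : 0 <= X by rewrite mulr_ge0.
apply: (@le_trans _ _ X).
  rewrite /X mulrAC ler_wpM2l//; exact: wrho.
have -> : X = (X `^ p n) `^ (p n)^-1 by rewrite -powRrM mulfV ?gt_eqF// powRr1.
by rewrite ge0_ler_powR ?nnegrE ?invr_ge0 ?powR_ge0 ?(ltW p0).
Qed.

End InverseClosed.

Theorem theorem4p2 (R : realType) (A : banachAlgType R[i])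
    (p : nat -> R) (w : nat -> int -> R) (pw : typeII_family p w) :
  (forall (s : side) (f : int -> A),
    ell_union p w f ->
    (forall z : R[i], `|z| = 1 ->
      exists a : A, is_inverse s *%R 1 a (fourier f z)) ->
    (forall j : nat, ellp (p j) (w j) f ->
      ~ admissible (w j) -> admissible (w j.+1) ->
      forall m n : nat, (j < m)%N -> (m < n)%N -> p m < p n) ->
    exists nu : nat -> int -> R,
      (forall n, weight (nu n)) /\
      (forall n x, nu n x <= w n x) /\
      ((forall k, admissible (w k)) \/ (forall k, ~ admissible (w k)) ->
        forall n, (constant_weight (w n) -> constant_weight (nu n)) /\
                  (~ constant_weight (w n) -> ~ constant_weight (nu n))) /\
      (forall n, (admissible (w n) -> admissible (nu n)) /\
                 (~ admissible (w n) -> ~ admissible (nu n))) /\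
      (forall n x, nu n.+1 x <= nu n x) /\
      (exists2 g : int -> A, ell_union p nu g &
        is_inverse s convz delta0 g f) /\
      typeII_algebra (ell_union p nu : set (int -> A))) /\
  (inverse_closed (ell_union p w : set (int -> A)) <-> extended_GRS w).
Proof.
have [p01 pS ww wS] := pw.
split; last by split; [exact: inverse_closed_GRS|exact: GRS_inverse_closed].
move=> s f [j _ fj] hf _.
have [beta b1 h] := two_sided_wiener (p01 j) (ww j) fj hf.
have [C [B [C1 B1 hB]]] := weight_exp_bound (ww j).
have eb : 0 < beta - 1 by rewrite subr_gt0.
have /cvgrPdist_le/(_ _ eb) hr := root_cvg1 B1.
(* Since [w j] is at most C B^|x|, its k-th root grows like B^(|x|/k), and B^(1/k) is at most [beta]
   for large k. *)
have [k [k0 hk]] := filter_ex (filterI (nbhs_infty_gt 0) hr).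
have Bk : B `^ k%:R^-1 <= beta.
  have := le_trans (ler_norm _) hk; have := ler_norm (B `^ k%:R^-1 - 1).
  rewrite distrC => + _; move=> /le_trans/(_ hk); lra.
have wr n := rootw_weight k (ww n).
have fam : typeII_family p (fun n => rootw k (w n)).
  by split=> // n x; apply: rootw_mono.
(* One k for all n keeps the family decreasing, and roots preserve and reflect constancy and
   admissibility. Only the weight of index j is compared with [beta], because the inverse is found
   in the j-th space. *)
exists (fun n => rootw k (w n)).
split; first exact: wr.
split; first by move=> n x; exact: rootw_le.
split; first by move=> _ n; have := rootw_constant (ww n) k0; tauto.
split; first by move=> n; have := rootw_admissible (ww n) k0; tauto.
split; first by move=> n x; exact: rootw_mono.
split; last first.
  split; first exact: typeII_subalgebra.
  by exists p, (fun n => rootw k (w n)).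
have [||g pg ig] := h (rootw k (w j)) (wr j); last first.
- by exists g; [exists j|].
- exists (C `^ k%:R^-1) => x.
  have B0 : 0 <= B by apply: le_trans B1.
  have C0 : 0 <= C by apply: le_trans C1.
  have [wj1 _] := ww j.
  apply: (@le_trans _ _ ((C * B ^+ `|x|%N) `^ k%:R^-1)).
    rewrite /rootw ge0_ler_powR ?nnegrE ?invr_ge0 ?mulr_ge0 ?exprn_ge0//.
    exact: le_trans (wj1 x).
  rewrite powRM ?exprn_ge0// ler_wpM2l ?powR_ge0//.
  by rewrite powR_expr// lerXn2r ?nnegrE ?powR_ge0// (le_trans ler01)// ltW.
by move=> x; exact: rootw_le.
Qed.
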